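(* Let $b\geq 5$ be an odd integer and $q=b/2$. There exist $\varepsilon>0$ and $s>0$ such that the curves $\gamma_{s,\varepsilon}\coloneqq \gamma|_{[-s,\varepsilon]}$ and $\bar\gamma_{s,\varepsilon}\coloneqq \bar\gamma|_{[-s,\varepsilon]}$ are length-minimizing in the sub-Riemannian manifold $\mathcal M$, i.e. $L_{\rm SR}(\gamma_{s,\varepsilon})=d_{\rm SR}(\gamma(-s),\gamma(\varepsilon))$ and $L_{\rm SR}(\bar\gamma_{s,\varepsilon})=d_{\rm SR}(\bar\gamma(-s),\bar\gamma(\varepsilon))$.
   Context: Fix an odd integer $b\geq5$ and set $q=b/2$. Let $P(x)=x_1^2-x_2^b$ for $x=(x_1,x_2,x_3)\in\mathbb{R}^3$. On $\mathbb{R}^3$ let $X_1=\partial_{x_1}$ and $X_2=\partial_{x_2}+P(x)^2\partial_{x_3}$, and let $\mathcal M=(\mathbb{R}^3,\Delta,g)$ be the sub-Riemannian manifold with $\Delta=\mathrm{span}\{X_1,X_2\}$ and $g$ the metric on $\Delta$ making $\{X_1,X_2\}$ orthonormal. A horizontal curve is an absolutely continuous $\eta:[0,T]\to\mathbb{R}^3$ with $\dot\eta\in\Delta$ a.e.; its length is $L_{\rm SR}(\eta)=\int_0^T\sqrt{g(\dot\eta,\dot\eta)}\,dt$, and $d_{\rm SR}(p,q)$ is the infimum of lengths of horizontal curves joining $p$ and $q$. Define $\gamma,\bar\gamma:\mathbb{R}\to\mathbb{R}^3$ by $\gamma(t)=\bar\gamma(t)=(0,t,\tfrac{t^{2b+1}}{2b+1})$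 for $t<0$, and $\gamma(t)=(t^q,t,0)$, $\bar\gamma(t)=(-t^q,t,0)$ for $t\geq0$. *)

(* Defs.v *)
From HB Require Import structures.
From mathcomp Require Import all_boot all_order all_algebra.
From mathcomp Require Import all_classical all_reals all_analysis.
Set Implicit Arguments. Unset Strict Implicit. Unset Printing Implicit Defensive.
Import Order.TTheory GRing.Theory Num.Theory.
Import numFieldNormedType.Exports.
Local Open Scope classical_set_scope.
Local Open Scope ring_scope.

Section SR.
Variable R : realType.

Definition pt := (R * R * R)%type.
Definition x1 (p : pt) : R := p.1.1.
Definition x2 (p : pt) : R := p.1.2.
Definition x3 (p : pt) : R := p.2.

Definition Ppoly (b : nat) (p : pt) : R := x1 p ^+ 2 - x2 p ^+ b.

Definition abs_cont (a c : R) (f : R -> R) : Prop :=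
  forall e : R, 0 < e -> exists2 d : R, 0 < d &
    forall (n : nat) (u v : nat -> R),
      (forall i, (i < n)%N -> a <= u i /\ u i <= v i /\ v i <= c) ->
      (forall i, (i.+1 < n)%N -> v i <= u i.+1) ->
      \sum_(i < n) (v i - u i) < d ->
      \sum_(i < n) `|f (v i) - f (u i)| < e.

(* horizontal curve eta : [a,c] -> R^3 for Delta = span{X1, X2},
   X1 = d/dx1, X2 = d/dx2 + P^2 d/dx3: absolutely continuous and for a.e. t,
   eta'(t) = u1 X1(eta t) + u2 X2(eta t), i.e. eta3' = P(eta)^2 eta2'. *)
Definition horizontal (b : nat) (a c : R) (eta : R -> pt) : Prop :=
  a <= c /\
  abs_cont a c (x1 \o eta) /\ abs_cont a c (x2 \o eta) /\
  abs_cont a c (x3 \o eta) /\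
  {ae (@lebesgue_measure R), forall t, t \in `[a, c] ->
     [/\ derivable (x1 \o eta) t 1, derivable (x2 \o eta) t 1,
         derivable (x3 \o eta) t 1 &
         derive1 (x3 \o eta) t = Ppoly b (eta t) ^+ 2 * derive1 (x2 \o eta) t]}.

(* sub-Riemannian length: g(eta',eta') = (eta1')^2 + (eta2')^2 since
   {X1,X2} is orthonormal and eta' = eta1' X1 + eta2' X2 *)
Definition sr_length (a c : R) (eta : R -> pt) : \bar R :=
  (\int[@lebesgue_measure R]_(t in `[a, c])
     (Num.sqrt ((derive1 (x1 \o eta) t) ^+ 2 + (derive1 (x2 \o eta) t) ^+ 2))%:E)%E.

Definition d_SR (b : nat) (p q : pt) : \bar R :=
  ereal_inf [set l | exists (T : R) (eta : R -> pt),
    [/\ horizontal b 0 T eta, eta 0 = p, eta T = q & l = sr_length 0 T eta]].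

Definition gamma (b : nat) (t : R) : pt :=
  if t < 0 then (0, t, t ^+ (2 * b + 1) / (2 * b + 1)%:R)
  else (t `^ (b%:R / 2), t, 0).

Definition gammabar (b : nat) (t : R) : pt :=
  if t < 0 then (0, t, t ^+ (2 * b + 1) / (2 * b + 1)%:R)
  else (- t `^ (b%:R / 2), t, 0).

End SR.

(* Main.v *)
Require Import Defs.
From HB Require Import structures.
From mathcomp Require Import all_boot all_order all_algebra.
From mathcomp Require Import all_classical all_reals all_analysis.
From mathcomp Require Import measurable_realfun.
From mathcomp Require Import ring lra zify.
Import Order.TTheory GRing.Theory Num.Theory.
Import numFieldNormedType.Exports.
Local Open Scope classical_set_scope.
Local Open Scope ring_scope.
Set Implicit Arguments. Unset Strict Implicit. Unset Printing Implicit Defensive.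

(* Write r = sqrt y (0 for y < 0), so that the planar profile of gamma is
   x = f(y) = r ^ b, and calibrate by the unit tangent (sine y, 1 / speed y) of
   this profile.  For a competitor with the same end points, its length exceeds
   that of gamma by E - G: the total excess E >= 0 of the length element over
   the calibration, minus the gain G, the integral of (x - f) * sine' dy.
   Horizontality forces the integral of Q dy to vanish, where Q >= 0 is
   P ^ 2 minus its value on gamma at the same height.  Hence moving forward off
   gamma has to be paid for by moving backward, and backward motion costs
   excess: at scale rho one has (x - f) * sine' <~ rho ^ (- 2 b - 4) * Q + a term
   of total mass rho ^ (2 b - 2).  Moreover max Q <~ E ^ 2: on the last stretch
   before the maximum of Q, the vanishing of the integral of Q dy bounds the
   variation of the curve by E, and sqrt Q is comparable to a Lipschitz function.
   Choosing rho ^ (2 b - 2) ~ E, the coefficient of the backward excess is of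
   order rho ^ (- 2 b - 4) * E ^ 2 ~ rho ^ (2 b - 8), which is small because
   b >= 5, and so G < E.
   Below b = m + 5. *)

(** * Absolutely continuous functions *)

Section AbsCont.
Variable R : realType.
Notation mu := (@lebesgue_measure R).
Implicit Types (a c t d e K : R) (F G H : R -> R).

(** Real induction. The step crosses [t] from a point on its left to a point on its right, so it
    both rules out a supremum below [c] and carries [P] to [c] itself. *)
Lemma continuous_induction a c (P : R -> Prop) : a <= c -> P a ->
  (forall t, a <= t <= c -> exists2 d, 0 < d & forall t1 t2,
     a <= t1 -> t1 <= t -> t <= t2 -> t2 <= c -> t2 - t1 < d -> P t1 -> P t2) ->
  P c.
Proof.
move=> ac Pa step.
pose S := [set t | a <= t <= c /\ P t].
have Sa : S a by split; rewrite ?lexx.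
have ubS : ubound S c by move=> t [/andP[]].
have hsS : has_sup S by split; [exists a|exists c].
have sa : a <= sup S by apply: ub_le_sup => //; exists c.
have sc : sup S <= c by apply: ge_sup => //; exists a.
have [d d0 Hd] := step (sup S) (introT andP (conj sa sc)).
have [t [/andP[at_ tc] Pt] tS] := sup_adherent d0 hsS.
have tsup : t <= sup S by apply: ub_le_sup => //; [exists c|split; [apply/andP|]].
(* Since [sup S - d < t], the point [t'] lies within [d] of [t], and beyond [sup S] unless capped by
   [c]. *)
pose t' := Num.min c (sup S + (t - (sup S - d)) / 2).
have Pt' : P t'.
  apply: (Hd t) => //.
  - by rewrite /t' le_min sc /= lerDl; lra.
  - by rewrite /t' ge_min lexx.
  - have : t' <= sup S + (t - (sup S - d)) / 2 by rewrite /t' ge_min lexx orbT.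
    by lra.
have t'S : t' <= sup S.
  apply: ub_le_sup; first by exists c.
  split=> //; apply/andP; split; last by rewrite /t' ge_min lexx.
  by rewrite /t' le_min ac /=; lra.
move: t'S Pt'; rewrite /t' ge_min => /orP[cS|]; last by lra.
by rewrite min_l//; lra.
Qed.

Lemma is_derive_littleo t F d e : is_derive t (1 : R) F d -> 0 < e ->
  exists2 r, 0 < r & forall u, `|u - t| < r ->
    `|F u - F t - d * (u - t)| <= e * `|u - t|.
Proof.
move=> [dF DF] e0.
have : h^-1 *: (F (h *: (1:R) + t) - F t) @[h --> 0^'] --> d.
  by rewrite -DF; exact: dF.
move=> /cvgrPdist_le /(_ e e0) [r /= r0 Hr].
exists r => // u utr.
have [->|ut] := eqVneq u t.
  by rewrite !subrr mulr0 subrr normr0 mulr0.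
have ut0 : u - t != 0 by rewrite subr_eq0.
have := Hr (u - t); rewrite /= sub0r normrN => /(_ utr ut0).
rewrite [_ *: 1]mulr1 subrK => H.
have -> : F u - F t - d * (u - t) = - ((u - t) * (d - (u - t)^-1 *: (F u - F t))).
  by rewrite /GRing.scale /=; field.
by rewrite normrN normrM mulrC ler_wpM2r.
Qed.

Lemma abs_contS a c a' c' F : a <= a' -> c' <= c -> abs_cont a c F -> abs_cont a' c' F.
Proof.
move=> aa cc AF e e0; have [d d0 Hd] := AF e e0; exists d => // n u v uv.
by apply: Hd => i /uv; lra.
Qed.

Lemma null_set_endpoints (N : set R) a c : measurable N -> mu N = 0%E ->
  measurable (N `|` [set a] `|` [set c]) /\ mu (N `|` [set a] `|` [set c]) = 0%E.
Proof.
move=> mN muN; have mNa : measurable (N `|` [set a]) by exact: measurableU.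
split; first exact: measurableU.
apply/eqP; rewrite -measure_le0.
apply: (@le_trans _ _ (mu N + mu [set a] + mu [set c])%E).
  apply: (le_trans (measureU2 _ _ _)) => //.
  by apply: leeD => //; apply: measureU2.
by rewrite muN !lebesgue_measure_set1 !adde0.
Qed.

(* A null set of bad points is covered by an open set [U] of small measure, on
   which the increments of [F] are controlled by absolute continuity; a
   continuous induction then runs through the good points and [U]. *)
Lemma abs_cont_ge0_nondecreasing a c F : a <= c -> abs_cont a c F ->
  {ae mu, forall t, a < t < c -> exists2 d, is_derive t (1 : R) F d & 0 <= d} ->
  F a <= F c.
Proof.
move=> ac AF [N [mN muN subN]].
suff H e : 0 < e -> F a <= F c + e * (c - a) + e.
  rewrite leNgt; apply/negP => FcFa.
  have e0 : 0 < (F a - F c) / (2 * (c - a + 1)) by rewrite divr_gt0//; lra.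
  have := H _ e0; set e := (_ / _).
  have : e * (2 * (c - a + 1)) = F a - F c by rewrite /e; field; lra.
  by nra.
move=> e0.
have [d d0 Hd] := AF e e0.
pose N' := N `|` [set a] `|` [set c].
have [mN' muN'] : measurable N' /\ mu N' = 0%E by exact: null_set_endpoints.
have [U [oU N'U muU]] : exists U : set R, [/\ open U, N' `<=` U & (mu U < d%:E)%E].
  have [|U [oU NU muU]] := @lebesgue_regularity_outer R N' d mN' _ d0.
    by apply: (@le_lt_trans _ _ 0%E); [rewrite -muN'|exact: ltry].
  exists U; split=> //.
  have mU : measurable U by exact: open_measurable.
  rewrite -(setDUK NU) (le_lt_trans (measureU2 _ _ _))//; first exact: measurableD.
  by rewrite [X in (X + _)%E](_ : _ = 0%E) ?add0e//; exact: muN'.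
have mU : measurable U by exact: open_measurable.
(* The invariant: up to [t], [F] has dropped by at most [e * (t - a)] plus its increments over
   finitely many ordered intervals, whose total length is at most the measure of [U] to the left of
   [t]. *)
pose P t := exists n (u v : nat -> R),
  [/\ forall i, (i < n)%N -> a <= u i /\ u i <= v i /\ v i <= t,
      forall i, (i.+1 < n)%N -> v i <= u i.+1,
      ((\sum_(i < n) (v i - u i))%:E <= mu (U `&` `[a, t]))%E &
      F a <= F t + e * (t - a) + \sum_(i < n) `|F (v i) - F (u i)|].
suff [n [u [v [uv vu suv FF]]]] : P c.
  have : \sum_(i < n) `|F (v i) - F (u i)| < e.
    apply: Hd => //; rewrite -lte_fin; apply: (le_lt_trans suv).
    by apply: le_lt_trans muU; apply: le_measure => //; rewrite inE//; exact: measurableI.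
  by lra.
apply: (continuous_induction ac).
  exists 0%N, (fun=> 0), (fun=> 0); split=> //; rewrite !big_ord0//.
  by lra.
move=> t /andP[at_ tc].
(* At a point of [U], the interval [[t1, t2]] lies in [U] and is appended to the list; at any other
   point the first-order expansion pays with [e * (t2 - t1)] and the list is unchanged. *)
have [Ut|nUt] := pselect (U t).
  have [r /= r0 tU] : \forall r \near 0^'+, ball t r `<=` U.
    have := oU; rewrite openE => /(_ _ Ut) /nbhs_ballP [r /= r0 rU].
    near=> x; apply: subset_trans rU; apply: le_ball.
    by near: x; exact: nbhs_right_le.
  exists (r / 2); first by rewrite divr_gt0.
  move=> t1 t2 at1 t1t tt2 t2c t12 [n [u [v [uv vu suv FF]]]].
  have t12U s : t1 <= s -> s <= t2 -> U s.
    move=> t1s st2; apply: (tU (r/2)) => //=.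
    - by rewrite sub0r normrN gtr0_norm; lra.
    - by lra.
    - rewrite /ball /= ltr_distl; lra.
  exists n.+1, (fun i => if (i < n)%N then u i else t1),
    (fun i => if (i < n)%N then v i else t2); split.
  - move=> i ni; case: ifP => [ /uv|_]; lra.
  - move=> i; rewrite ltnS => ni; rewrite ni.
    case: ifP => [|_]; first exact: vu.
    by have := uv _ ni; lra.
  - rewrite big_ord_recr /= ltnn EFinD.
    rewrite (eq_bigr (fun i : 'I_n => v i - u i)); last by move=> i _; rewrite ltn_ord.
    have -> : U `&` `[a, t2] = (U `&` `[a, t1]) `|` `]t1, t2]%classic.
      apply/seteqP; split => s /=; rewrite !in_itv/=.
        move=> [Us /andP[as_ st2]]; rewrite as_ st2 andbT /=.
        by have [] := leP s t1; [left|right].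
      case=> [[Us /andP[as_ st]]|/andP[ts st]]; (split; first by [|apply: t12U; lra]).
        by lra.
      by lra.
    rewrite measureU//=; last 2 first.
      by apply: measurableI.
      apply/seteqP; split => s //=; rewrite !in_itv/=; lra.
    apply: leeD => //.
    by rewrite lebesgue_measure_itv /= lte_fin; case: ltP => //; rewrite lee_fin; lra.
  - rewrite big_ord_recr /= ltnn.
    rewrite (eq_bigr (fun i : 'I_n => `|F (v i) - F (u i)|)); last first.
      by move=> i _; rewrite ltn_ord.
    have := ler_norm (F t1 - F t2); rewrite distrC.
    have : 0 <= e * (t2 - t1) by rewrite mulr_ge0; lra.
    by move: FF; rewrite mulrBr mulrBr mulrBr; lra.
have nN't : ~ N' t by move/N'U.
have act : a < t < c.
  rewrite !lt_neqAle at_ tc !andbT; apply/andP; split; apply/eqP => tE; apply: nN't.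
  - by rewrite -tE /N'; left; right.
  - by rewrite tE; right.
have [D dF D0] : exists2 d, is_derive t (1 : R) F d & 0 <= d.
  apply: contrapT => nd; apply: nN't; left; left; apply: subN => /=.
  by move=> /(_ act).
have [r r0 Hr] := is_derive_littleo dF e0.
exists r => // t1 t2 at1 t1t tt2 t2c t12 [n [u [v [uv vu suv FF]]]].
exists n, u, v; split=> //.
- by move=> i /uv; lra.
- apply: (le_trans suv); apply: le_measure; rewrite ?inE; try exact: measurableI.
  apply: setIS => s /=; rewrite !in_itv/=; lra.
- have /ler_normlP[H1 _] : `|F t2 - F t - D * (t2 - t)| <= e * `|t2 - t|.
    by apply: Hr; rewrite ger0_norm; lra.
  have /ler_normlP[_ H2] : `|F t1 - F t - D * (t1 - t)| <= e * `|t1 - t|.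
    by apply: Hr; rewrite ler0_norm; lra.
  rewrite ger0_norm ?subr_ge0// in H1.
  rewrite ler0_norm ?subr_le0// in H2.
  by nra.
Unshelve. all: by end_near. Qed.
End AbsCont.

(** * Closure properties and measurable derivatives *)

Section AbsContClosure.
Variable R : realType.
Notation mu := (@lebesgue_measure R).
Implicit Types (a c t d e K : R) (F G H : R -> R).

Lemma abs_cont_dom a c F G H K :
  (forall u v, a <= u -> u <= v -> v <= c ->
     `|F v - F u| <= K * (`|G v - G u| + `|H v - H u|)) ->
  abs_cont a c G -> abs_cont a c H -> abs_cont a c F.
Proof.
move=> FGH AG AH e e0.
have K0 : 0 < `|K| + 1 by rewrite ltr_wpDl.
have e'0 : 0 < e / (2 * (`|K| + 1)) by rewrite divr_gt0// mulr_gt0.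
have [d1 d10 H1] := AG _ e'0; have [d2 d20 H2] := AH _ e'0.
exists (Num.min d1 d2); first by rewrite lt_min d10.
move=> n u v uv vu; rewrite lt_min => /andP[/(H1 _ _ _ uv vu) {}H1 /(H2 _ _ _ uv vu) {}H2].
apply: (@le_lt_trans _ _ ((`|K| + 1) *
    (\sum_(i < n) `|G (v i) - G (u i)| + \sum_(i < n) `|H (v i) - H (u i)|))).
  rewrite -big_split mulr_sumr; apply: ler_sum => i _.
  have [au [uvi vc]] := uv _ (ltn_ord i).
  apply: (le_trans (FGH _ _ au uvi vc)); apply: ler_wpM2r; first by rewrite addr_ge0.
  by apply: (le_trans (ler_norm K)); rewrite lerDl.
have := ltrD H1 H2; rewrite -(ltr_pM2l K0) => /lt_le_trans; apply.
by rewrite le_eqVlt; apply/orP; left; apply/eqP; field; rewrite gt_eqF.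
Qed.

Lemma abs_cont_id a c : abs_cont a c id.
Proof.
move=> e e0; exists e => // n u v uv _; apply: le_lt_trans.
by apply: ler_sum => i _; have [_ [? _]] := uv _ (ltn_ord i); rewrite ger0_norm ?subr_ge0.
Qed.

Lemma abs_cont_lip a c F K :
  (forall u v, a <= u -> u <= v -> v <= c -> `|F v - F u| <= K * (v - u)) ->
  abs_cont a c F.
Proof.
move=> FK; apply: (@abs_cont_dom _ _ F id id (`|K|)); [|exact: abs_cont_id..].
move=> u v au uv vc; apply: (le_trans (FK _ _ au uv vc)).
rewrite /= (@ger0_norm _ (v - u)) ?subr_ge0//.
have : K * (v - u) <= `|K| * (v - u) by rewrite ler_wpM2r ?subr_ge0// ler_norm.
have : 0 <= `|K| * (v - u) by rewrite mulr_ge0 ?subr_ge0.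
by lra.
Qed.

Lemma abs_contD a c F G : abs_cont a c F -> abs_cont a c G ->
  abs_cont a c (fun t => F t + G t).
Proof.
apply: (@abs_cont_dom _ _ _ _ _ 1) => u v _ _ _.
by rewrite mul1r opprD addrACA ler_normD.
Qed.

Lemma abs_contZ a c F K : abs_cont a c F -> abs_cont a c (fun t => K * F t).
Proof.
move=> AF; apply: (@abs_cont_dom _ _ _ F F (`|K|)) => // u v _ _ _.
by rewrite -mulrBr normrM ler_wpM2l// lerDl.
Qed.

Lemma abs_contB a c F G : abs_cont a c F -> abs_cont a c G ->
  abs_cont a c (fun t => F t - G t).
Proof.
move=> AF AG; apply: (@abs_cont_dom _ _ _ F G 1) => // u v _ _ _.
rewrite mul1r (_ : F v - G v - _ = (F v - F u) - (G v - G u)); last by ring.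
exact: ler_normB.
Qed.

(** Clamping the argument gives a continuous function on the whole line, to which facts about global
    continuity apply. *)
Lemma abs_cont_clamp a c F : a <= c -> abs_cont a c F ->
  continuous (fun t => F (Num.max a (Num.min c t))).
Proof.
move=> ac AF t; apply/cvgrPdist_lt => e e0.
have [d d0 Hd] := AF e e0.
have H u v : u <= v -> v - u < d ->
    `|F (Num.max a (Num.min c v)) - F (Num.max a (Num.min c u))| < e.
  move=> uv uvd.
  have := Hd 1%N (fun=> Num.max a (Num.min c u)) (fun=> Num.max a (Num.min c v)).
  rewrite !big_ord1; apply=> //.
  - move=> _ _; rewrite le_max lexx; split=> //; split; last by rewrite ge_max ac ge_min lexx.
    by rewrite ge_max le_max lexx/= le_max le_min !ge_min lexx uv !orbT.
  - rewrite /Num.max /Num.min; do ?case: ifP; lra.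
near=> s.
have std : `|t - s| < d by near: s; apply: cvgr_dist_lt.
move: std; have [ts|/ltW st] := leP t s.
  by rewrite distrC ger0_norm ?subr_ge0// => std; rewrite distrC; apply: H.
by rewrite ger0_norm ?subr_ge0// => std; apply: H.
Unshelve. all: by end_near. Qed.

Lemma clamp_id a c t : a <= t <= c -> Num.max a (Num.min c t) = t.
Proof. by move=> /andP[at_ tc]; rewrite min_r// max_r. Qed.

Lemma abs_cont_within a c F : a <= c -> abs_cont a c F ->
  {within `[a, c], continuous F}.
Proof.
move=> ac AF.
apply: (@subspace_eq_continuous _ _ _ (fun t => F (Num.max a (Num.min c t)))).
  by move=> t; rewrite inE/= in_itv/= => /clamp_id ->.
by apply: continuous_subspaceT; exact: abs_cont_clamp.
Qed.

Lemma abs_cont_bounded a c F : a <= c -> abs_cont a c F ->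
  exists2 B, 0 <= B & forall t, a <= t <= c -> `|F t| <= B.
Proof.
move=> ac AF.
have cF : {within `[a, c], continuous (fun t => `|F t|)}.
  move=> t; apply: continuous_comp; last exact: norm_continuous.
  exact: abs_cont_within.
have [s _ Hs] := EVT_max ac cF.
by exists (`|F s|) => // t tac; apply: Hs; rewrite in_itv.
Qed.

Lemma abs_contM a c F G : a <= c -> abs_cont a c F -> abs_cont a c G ->
  abs_cont a c (fun t => F t * G t).
Proof.
move=> ac AF AG.
have [B1 B10 HF] := abs_cont_bounded ac AF; have [B2 B20 HG] := abs_cont_bounded ac AG.
apply: (@abs_cont_dom _ _ _ F G (B1 + B2)) => // u v au uv vc.
have -> : F v * G v - F u * G u = F v * (G v - G u) + (F v - F u) * G u by ring.
apply: (le_trans (ler_normD _ _)); rewrite !normrM.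
have := HF v; have := HG u; rewrite au vc (le_trans uv vc) (le_trans au uv).
move=> /(_ isT) HGu /(_ isT) HFv.
have := normr_ge0 (G v - G u); have := normr_ge0 (F v - F u).
by nra.
Qed.

Lemma is_derive_continuous F G : (forall t, is_derive t (1 : R) F (G t)) -> continuous F.
Proof.
move=> dF t; apply: differentiable_continuous; apply/derivable1_diffP.
by have [] := dF t.
Qed.

Lemma is_derive_bound F G (B K : R) :
  (forall t, is_derive t (1 : R) F (G t)) ->
  (forall t, `|t| <= B -> `|G t| <= K) ->
  forall u v, `|u| <= B -> `|v| <= B -> `|F v - F u| <= K * `|v - u|.
Proof.
move=> dF GK.
have H u v : u <= v -> `|u| <= B -> `|v| <= B -> `|F v - F u| <= K * `|v - u|.
  move=> uv uB vB.
  have /andP[u1 u2] : - B <= u <= B by rewrite -ler_norml.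
  have /andP[v1 v2] : - B <= v <= B by rewrite -ler_norml.
  have cF : {within `[u, v], continuous F}.
    by apply: continuous_subspaceT; exact: is_derive_continuous dF.
  have [s suv /= ->] := MVT_segment uv (fun t _ => dF t) cF.
    rewrite normrM ler_wpM2r// GK// ler_norml.
  by move: suv; rewrite in_itv/=; lra.
move=> u v uB vB; have [uv|/ltW vu] := leP u v; first exact: H.
by rewrite distrC (distrC v); exact: H.
Qed.

Lemma abs_cont_comp a c F G (phi : R -> R) : a <= c ->
  (forall y, is_derive y (1 : R) phi (G y)) -> continuous G ->
  abs_cont a c F -> abs_cont a c (fun t => phi (F t)).
Proof.
move=> ac dphi cG AF; have [B B0 HF] := abs_cont_bounded ac AF.
have NB : - B <= B by lra.
have cnG : {within `[- B, B], continuous (fun t => `|G t|)}.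
  apply: continuous_subspaceT => t; apply: continuous_comp; first exact: cG.
  exact: norm_continuous.
have [s _ Hs] := EVT_max NB cnG.
apply: (@abs_cont_dom _ _ _ F F (`|G s|)) => // u v au uv vc.
apply: le_trans (_ : `|G s| * `|F v - F u| <= _); last by rewrite ler_wpM2l// lerDl.
apply: (is_derive_bound dphi) (HF _ _) (HF _ _); [|lra|lra].
by move=> t tB; apply: Hs; rewrite in_itv/= -ler_norml.
Qed.

(** The upper limit of the difference quotients of step [1 / (n + 1)] is measurable everywhere and
    agrees with the derivative wherever the latter exists. The clamp makes these quotients globally
    continuous. *)
Lemma abs_cont_measurable_derive a c F : a <= c -> abs_cont a c F ->
  exists2 G, measurable_fun setT G &
    forall t d, a < t < c -> is_derive t (1 : R) F d -> G t = d.
Proof.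
move=> ac AF; pose F' t := F (Num.max a (Num.min c t)).
have cF' : continuous F' by exact: abs_cont_clamp.
pose g n t : \bar R := (n.+1%:R * (F' (t + n.+1%:R^-1) - F' t))%:E.
exists (fun t => fine (limn_esup (fun n => g n t))).
  apply: measurableT_comp; first exact: fine_measurable.
  apply: measurable_fun_limn_esup => n; apply/measurable_EFinP.
  apply: continuous_measurable_fun => t; apply: cvgM; first exact: cvg_cst.
  apply: cvgB; last exact: cF'.
  apply: continuous_comp; last exact: cF'.
  by apply: cvgD; [exact: cvg_id|exact: cvg_cst].
move=> t d /andP[at_ tc] dF.
suff gd : g n t @[n --> \oo] --> d%:E.
  by rewrite (cvg_limn_einf_sup gd).2.
apply: cvg_EFin; first by apply: nearW => n.
apply/cvgrPdist_le => e e0.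
have [r r0 Hr] := is_derive_littleo dF e0.
have r'0 : 0 < Num.min r (c - t) by rewrite lt_min r0 subr_gt0.
near=> n.
have nr : n.+1%:R^-1 < Num.min r (c - t).
  by near: n; exact: near_infty_natSinv_lt (PosNum r'0).
have n0 : 0 < n.+1%:R^-1 :> R by rewrite invr_gt0 ltr0n.
move: nr; rewrite lt_min => /andP[nr nc].
have N0 : 0 < n.+1%:R :> R by rewrite ltr0n.
rewrite /= /F'; move: nr nc n0; set k := _^-1 => nr nc n0.
have kt : a <= t + k <= c by lra.
have tac : a <= t <= c by lra.
rewrite (clamp_id kt) (clamp_id tac).
have := Hr (t + k); rewrite (_ : t + k - t = k); last by ring.
rewrite gtr0_norm// => /(_ nr) H.
rewrite distrC -(ler_pM2r n0); apply: le_trans H.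
rewrite -{2}(gtr0_norm n0) -normrM le_eqVlt; apply/orP; left; apply/eqP; congr `| _ |.
have kN : k * n.+1%:R = 1 by rewrite /k mulVf ?gt_eqF.
by rewrite mulrBl (mulrC _ k) mulrA kN mul1r.
Unshelve. all: by end_near. Qed.
End AbsContClosure.

(** * Primitives of integrable functions and the speed of a horizontal curve *)

Section Primitive.
Variable R : realType.
Notation mu := (@lebesgue_measure R).
Implicit Types (a c t d e : R) (F G g : R -> R).

(** Prepares the use of absolute continuity of the integral, which speaks of one set of small
    measure. Half-open intervals keep neighbours with a common end point disjoint. *)
Lemma intervals_union_measure (n : nat) (u v : nat -> R) (g : R -> R) :
  (forall i, (i < n)%N -> u i <= v i) ->
  (forall i, (i.+1 < n)%N -> v i <= u i.+1) ->
  mu.-integrable setT (EFin \o g) ->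
  exists A, [/\ measurable A, mu A = (\sum_(i < n) (v i - u i))%:E,
    forall s, A s -> exists2 i, (i < n)%N & s <= v i &
    \sum_(i < n) \int[mu]_(s in `]u i, v i]) `|g s| = \int[mu]_(s in A) `|g s|].
Proof.
move=> uv vu ig; have ing : mu.-integrable setT (EFin \o (fun s => `|g s|)).
  have := integrable_abse ig; apply: eq_integrable => //.
elim: n uv vu => [|n IH] uv vu.
  exists set0; split=> //; first by rewrite big_ord0 measure0.
  by rewrite big_ord0 Rintegral_set0.
have vun i : (i < n)%N -> v i <= u n.
  elim: n {IH} uv vu i => // n IH uv vu i.
  rewrite ltnS leq_eqVlt => /predU1P[->|iltn]; first exact: vu.
  apply: (@le_trans _ _ (u n)).
    apply: IH => // [j jn|j jn]; [apply: uv|apply: vu]; exact: ltnW.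
  by apply: (le_trans (uv n _) (vu n _)) => //; exact: ltnW.
have [|i ni|A [mA muA Av intA]] := IH.
- by move=> i ni; apply: uv; exact: ltnW.
- by apply: vu; exact: ltnW.
exists (A `|` `]u n, v n]); split.
- exact: measurableU.
- rewrite big_ord_recr/= EFinD -muA measureU//; last first.
    apply/seteqP; split => s //= [/Av[i ni svi]]; rewrite in_itv/= => /andP[us _].
    by have := vun i ni; lra.
  have muI : mu `]u n, v n] = (v n - u n)%:E.
    rewrite lebesgue_measure_itv/= lte_fin; case: ltP => // vnun.
    have := uv n (ltnSn n).
    by rewrite le_eqVlt ltNge vnun orbF => /eqP ->; rewrite subrr.
  by congr (_ + _)%E; exact: muI.
- move=> s [/Av[i ni svi]|]; first by exists i => //; exact: ltnW.
  by rewrite /= in_itv/= => /andP[_ svn]; exists n.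
- rewrite big_ord_recr/= intA Rintegral_setU//.
    by apply: integrableS ing => //; exact: measurableU.
  apply/eqP; apply/seteqP; split => s //= [/Av[i ni svi]]; rewrite in_itv/= => /andP[us _].
  by have := vun i ni; lra.
Qed.

(** Absolute continuity of the integral gives the first clause, Lebesgue differentiation the second;
    [g] is cut off outside [[a, c]] to be integrable on the whole line. *)
Lemma integrable_primitive a c g : a <= c -> measurable_fun setT g ->
  mu.-integrable `[a, c] (EFin \o g) ->
  exists J : R -> R, [/\ abs_cont a c J,
    {ae mu, forall t, a < t < c -> is_derive t (1 : R) J (g t)} &
    J c - J a = \int[mu]_(t in `[a, c]) g t].
Proof.
move=> ac mg ig; pose G := g \_ `[a, c].
have iG : mu.-integrable setT (EFin \o G).
  by move/integrable_mkcond : ig => /(_ (measurable_itv _)); rewrite restrict_EFin.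
have iGA A : measurable A -> mu.-integrable A (EFin \o G).
  by move=> mA; apply: integrableS iG.
pose J t := \int[mu]_(s in `]-oo, t]) G s.
have JB u v : u <= v -> J v - J u = \int[mu]_(s in `]u, v]) G s.
  by move=> uv; rewrite /J Rintegral_itvB ?bnd_simp//; exact: iGA.
exists J; split.
- move=> e e0; have [d [d0 Hd]] := integral_normr_continuous iG e0.
  exists d => // n u v uv vu uvd.
  have [|A [mA muA _ AG]] := intervals_union_measure _ vu iG.
    by move=> i /uv[_ []].
  have muAd : (mu A < d%:E)%E by rewrite muA lte_fin.
  apply: le_lt_trans (Hd A mA muAd).
  rewrite -AG; apply: ler_sum => i _; have [_ [uvi _]] := uv i (ltn_ord i).
  by rewrite JB//; apply: le_normr_Rintegral => //; exact: iGA.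
- have : locally_integrable setT G by apply: open_integrable_locally => //; exact: openT.
  move=> /(FTC1Ny (fun y => iGA _ (measurable_itv _))).
  apply: (@filterS _ _ (ae_filter_ringOfSetsType mu)) => t [dJ JE] /andP[at_ tc].
  apply: DeriveDef => //; rewrite -derive1E JE /G patchE ifT// inE/= in_itv/=.
  by rewrite !ltW.
- rewrite JB// Rintegral_itv_obnd_cbnd; last exact: iGA.
  by apply: eq_Rintegral => t; rewrite /G patchE => ->.
Qed.

(** A nonnegative integral is a supremum over simple functions below the integrand, so this also
    covers the integrand of [sr_length], built from [derive1], whose measurability is not
    established. *)
Lemma ge0_le_integral_dominated (D : set R) (f1 f2 : R -> \bar R) :
  (forall t, D t -> (0 <= f1 t)%E) -> (forall t, D t -> (f1 t <= f2 t)%E) ->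
  (\int[mu]_(t in D) f1 t <= \int[mu]_(t in D) f2 t)%E.
Proof.
move=> f10 f12.
have f20 t : D t -> (0 <= f2 t)%E by move=> Dt; apply: le_trans (f12 t Dt); exact: f10.
rewrite !ge0_integralE//; apply: le_ereal_sup => _ [h hf1 <-].
exists h => // t; apply: (le_trans (hf1 t)); rewrite !patchE; case: ifP => // tD.
by apply: f12; rewrite inE in tD.
Qed.

(** Replaces [derive1] by measurable representatives [X] and [Y]; for a competitor a lower bound on
    the length is enough. *)
Lemma horizontal_speed (b : nat) a c (eta : R -> pt R) :
  horizontal b a c eta -> (sr_length a c eta < +oo)%E ->
  exists X Y : R -> R, [/\ measurable_fun setT X, measurable_fun setT Y,
    {ae mu, forall t, a < t < c ->
      [/\ is_derive t (1 : R) (@x1 R \o eta) (X t),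
          is_derive t (1 : R) (@x2 R \o eta) (Y t) &
          is_derive t (1 : R) (@x3 R \o eta) (Ppoly b (eta t) ^+ 2 * Y t)]},
    mu.-integrable `[a, c] (EFin \o (fun t => Num.sqrt (X t ^+ 2 + Y t ^+ 2))) &
    ((\int[mu]_(t in `[a, c]) Num.sqrt (X t ^+ 2 + Y t ^+ 2))%:E <= sr_length a c eta)%E].
Proof.
move=> [ac [AX [AY [AZ ae_eta]]]] Loo.
have [X mX XE] := abs_cont_measurable_derive ac AX.
have [Y mY YE] := abs_cont_measurable_derive ac AY.
have dXY t : a < t < c -> [/\ derivable (@x1 R \o eta) t 1, derivable (@x2 R \o eta) t 1,
     derivable (@x3 R \o eta) t 1 &
     derive1 (@x3 R \o eta) t = Ppoly b (eta t) ^+ 2 * derive1 (@x2 R \o eta) t] ->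
     [/\ is_derive t (1 : R) (@x1 R \o eta) (X t),
          is_derive t (1 : R) (@x2 R \o eta) (Y t) &
          is_derive t (1 : R) (@x3 R \o eta) (Ppoly b (eta t) ^+ 2 * Y t)].
  move=> tac [d1 d2 d3 E3].
  have /(XE _ _ tac) X1 := derivableP d1; have /(YE _ _ tac) Y1 := derivableP d2.
  split; first by rewrite X1; exact: (derivableP d1).
    by rewrite Y1; exact: (derivableP d2).
  by rewrite Y1 -derive1E -E3 derive1E; exact: derivableP.
pose w t := Num.sqrt (X t ^+ 2 + Y t ^+ 2).
have mw : measurable_fun setT w.
  apply: measurableT_comp; first by apply: continuous_measurable_fun; exact: sqrt_continuous.
  by apply: measurable_funD; apply: measurable_funX.
have [N [mN muN subN]] : {ae mu, forall t, a < t < c ->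
      [/\ is_derive t (1 : R) (@x1 R \o eta) (X t),
          is_derive t (1 : R) (@x2 R \o eta) (Y t) &
          is_derive t (1 : R) (@x3 R \o eta) (Ppoly b (eta t) ^+ 2 * Y t)]}.
  move: ae_eta; apply: (@filterS _ _ (ae_filter_ringOfSetsType mu)) => t H /[dup] /andP[at_ tc] tac.
  by apply: dXY => //; apply: H; rewrite in_itv/= !ltW.
pose N' := N `|` [set a] `|` [set c].
have [mN' muN'] : measurable N' /\ mu N' = 0%E by exact: null_set_endpoints.
(* Setting the speed to 0 on the bad null set puts [w0] below the integrand of [sr_length] at every
   point, whatever value [derive1] has there. *)
pose w0 := w \_ (~` N').
have mw0 : measurable_fun `[a, c] (EFin \o w0).
  apply/measurable_EFinP; apply: (@measurable_funS _ _ _ _ setT) => //.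
  by apply/(measurable_restrictT _ _).1 => //; [exact: measurableC|exact: measurable_funS mw].
have int0 : (\int[mu]_(t in `[a, c]) (w t)%:E = \int[mu]_(t in `[a, c]) (w0 t)%:E)%E.
  apply: ge0_ae_eq_integral => //.
  - by apply/measurable_EFinP; exact: measurable_funS mw.
  - by move=> t _; rewrite lee_fin sqrtr_ge0.
  - by move=> t _; rewrite lee_fin /w0 patchE; case: ifP => // _; exact: sqrtr_ge0.
  - exists N'; split => // t /= H; apply: contrapT => nN; apply: H => _.
    by rewrite /w0 patchE ifT// inE.
have le0 : (\int[mu]_(t in `[a, c]) (w t)%:E <= sr_length a c eta)%E.
  rewrite int0; apply: ge0_le_integral_dominated => t.
    by move=> _; rewrite lee_fin /w0 patchE; case: ifP => // _; exact: sqrtr_ge0.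
  rewrite /= in_itv/= => /andP[at_ tc]; rewrite lee_fin /w0 patchE.
  case: ifP => [|_]; last exact: sqrtr_ge0.
  rewrite inE => nN't.
  have tac : a < t < c.
    rewrite !lt_neqAle at_ tc !andbT; apply/andP; split; apply/eqP => tE; apply: nN't.
    - by rewrite -tE; left; right.
    - by rewrite tE; right.
  have [dX dY _] : [/\ is_derive t (1 : R) (@x1 R \o eta) (X t),
          is_derive t (1 : R) (@x2 R \o eta) (Y t) &
          is_derive t (1 : R) (@x3 R \o eta) (Ppoly b (eta t) ^+ 2 * Y t)].
    apply: contrapT => nd; apply: nN't; left; left; apply: subN => /=.
    by move=> /(_ tac).
  by case: dX => _ EX; case: dY => _ EY; rewrite !derive1E EX EY.
have iw : mu.-integrable `[a, c] (EFin \o w).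
  apply/integrableP; split; first by apply/measurable_EFinP; exact: measurable_funS mw.
  apply: le_lt_trans Loo; apply: le_trans le0.
  by under eq_integral do rewrite /= ger0_norm ?sqrtr_ge0//.
exists X, Y; split=> //; first by exists N.
rewrite /Rintegral fineK//.
by apply: integrable_fin_num.
Qed.
End Primitive.

(** * Calculus with almost everywhere derivatives *)

Section AbsContDerive.
Variable R : realType.
Notation mu := (@lebesgue_measure R).

Definition ac_derive (a c : R) (F g : R -> R) : Prop :=
  abs_cont a c F /\ {ae mu, forall t, a < t < c -> is_derive t (1 : R) F (g t)}.

Implicit Types (a c t K : R) (F G g f X Y w : R -> R).

Lemma ac_derive_eq a c F g g' : (forall t, a < t < c -> g t = g' t) ->
  ac_derive a c F g -> ac_derive a c F g'.
Proof.
move=> gg [AF dF]; split=> //; move: dF.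
apply: (@filterS _ _ (ae_filter_ringOfSetsType mu)) => t H tac.
by rewrite -gg//; exact: H.
Qed.

Lemma ac_deriveS a c a' c' F g : a <= a' -> c' <= c ->
  ac_derive a c F g -> ac_derive a' c' F g.
Proof.
move=> aa cc [AF dF]; split; first exact: abs_contS AF.
move: dF; apply: (@filterS _ _ (ae_filter_ringOfSetsType mu)) => t H tac.
by apply: H; lra.
Qed.

Lemma ac_deriveD a c F G f g : ac_derive a c F f -> ac_derive a c G g ->
  ac_derive a c (fun t => F t + G t) (fun t => f t + g t).
Proof.
move=> [AF dF] [AG dG]; split; first exact: abs_contD.
move: dF dG; apply: (@filterS2 _ _ (ae_filter_ringOfSetsType mu)) => t dF dG tac.
by have := dF tac; have := dG tac => ? ?; exact: is_deriveD.
Qed.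

Lemma ac_deriveB a c F G f g : ac_derive a c F f -> ac_derive a c G g ->
  ac_derive a c (fun t => F t - G t) (fun t => f t - g t).
Proof.
move=> [AF dF] [AG dG]; split; first exact: abs_contB.
move: dF dG; apply: (@filterS2 _ _ (ae_filter_ringOfSetsType mu)) => t dF dG tac.
by have := dF tac; have := dG tac => ? ?; exact: is_deriveB.
Qed.

Lemma ac_deriveZ a c F f K : ac_derive a c F f ->
  ac_derive a c (fun t => K * F t) (fun t => K * f t).
Proof.
move=> [AF dF]; split; first exact: abs_contZ.
move: dF; apply: (@filterS _ _ (ae_filter_ringOfSetsType mu)) => t dF tac.
by have := dF tac => ?; exact: is_deriveZ.
Qed.

Lemma ac_deriveM a c F G f g : a <= c -> ac_derive a c F f -> ac_derive a c G g ->
  ac_derive a c (fun t => F t * G t) (fun t => f t * G t + F t * g t).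
Proof.
move=> ac [AF dF] [AG dG]; split; first exact: abs_contM.
move: dF dG; apply: (@filterS2 _ _ (ae_filter_ringOfSetsType mu)) => t dF dG tac.
have := dF tac; have := dG tac => ? ?.
by apply: is_derive_eq; rewrite /GRing.scale /= addrC (mulrC (f t)).
Qed.

Lemma ac_derive_comp a c F f (phi psi : R -> R) : a <= c ->
  (forall y, is_derive y (1 : R) phi (psi y)) -> continuous psi ->
  ac_derive a c F f ->
  ac_derive a c (fun t => phi (F t)) (fun t => psi (F t) * f t).
Proof.
move=> ac dphi cpsi [AF dF]; split; first exact: abs_cont_comp dphi cpsi AF.
move: dF; apply: (@filterS _ _ (ae_filter_ringOfSetsType mu)) => t dF tac.
by have := dF tac => ?; have ? := dphi (F t); exact: (@is_derive1_comp _ phi F).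
Qed.

(** The lower bound works with explicit primitives instead of integrals, and this is how pointwise
    inequalities get integrated. *)
Lemma ac_derive_le a c F f G g : a <= c -> ac_derive a c F f -> ac_derive a c G g ->
  (forall t, a < t < c -> f t <= g t) -> F c - F a <= G c - G a.
Proof.
move=> ac dF dG fg; have [AH dH] := ac_deriveB dG dF.
suff : G a - F a <= G c - F c by lra.
apply: (abs_cont_ge0_nondecreasing ac AH); move: dH.
apply: (@filterS _ _ (ae_filter_ringOfSetsType mu)) => t H tac.
by exists (g t - f t); [exact: H|rewrite subr_ge0 fg].
Qed.

Lemma ac_derive_cst a c K : ac_derive a c (fun=> K) (fun=> 0).
Proof.
split; first by apply: (@abs_cont_lip _ _ _ _ 0) => u v _ _ _; rewrite subrr normr0 mul0r.
by apply: (@filterE _ _ (ae_filter_ringOfSetsType mu)) => t _; exact: is_derive_cst.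
Qed.

Lemma ac_derive_C1 a c F f : (forall t, is_derive t (1 : R) F (f t)) -> continuous f ->
  a <= c -> ac_derive a c F f.
Proof.
move=> dF cf ac; split; first exact: (abs_cont_comp ac dF cf (@abs_cont_id _ _ _)).
by apply: (@filterE _ _ (ae_filter_ringOfSetsType mu)) => t _.
Qed.

Lemma ac_derive_primitive_mul a c G Y w : a <= c -> continuous G ->
  measurable_fun setT Y -> mu.-integrable `[a, c] (EFin \o w) ->
  (forall t, `|Y t| <= w t) ->
  exists J, ac_derive a c J (fun t => G t * Y t).
Proof.
move=> ac cG mY iw Yw.
have cnG : {within `[a, c], continuous (fun t => `|G t|)}.
  apply: continuous_subspaceT => t; apply: continuous_comp; first exact: cG.
  exact: norm_continuous.
have [s _ Hs] := EVT_max ac cnG.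
have mGY : measurable_fun setT (fun t => G t * Y t).
  by apply: measurable_funM => //; exact: continuous_measurable_fun.
have [|J [AJ dJ _]] := @integrable_primitive R a c (fun t => G t * Y t) ac mGY.
  have iGw : mu.-integrable `[a, c] (EFin \o (fun t => `|G s| * w t)).
    by have := @integrableZl _ _ _ mu _ (measurable_itv _) (`|G s|) _ iw.
  apply: le_integrable iGw => //.
    by apply/measurable_EFinP; exact: measurable_funS mGY.
  move=> t tac /=; rewrite lee_fin !normrM normr_id.
  apply: ler_pM => //; first by apply: Hs; move: tac; rewrite /= .
  by apply: (le_trans (Yw t)); exact: ler_norm.
by exists J.
Qed.
End AbsContDerive.

(** * The profile of the curves *)

Section SqrtPower.
Variable R : realType.
Implicit Types (y t d : R) (F : R -> R).

Lemma littleo_is_derive t F d :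
  (forall e, 0 < e -> exists2 r, 0 < r & forall h, h != 0 -> `|h| < r ->
    `|F (t + h) - F t - d * h| <= e * `|h|) ->
  is_derive t (1 : R) F d.
Proof.
move=> H.
have D : h^-1 *: (F (h *: (1:R) + t) - F t) @[h --> 0^'] --> d.
  apply/cvgrPdist_le => e e0; have [r r0 Hr] := H e e0.
  exists r => //= h; rewrite /= sub0r normrN => hr h0.
  have h00 : 0 < `|h| by rewrite normr_gt0.
  rewrite [_ *: 1]mulr1 -(ler_pM2r h00); apply: le_trans (Hr h h0 hr).
  rewrite -normrM -[leLHS]normrN le_eqVlt; apply/orP; left; apply/eqP.
  by congr `| _ |; rewrite /GRing.scale /= (addrC h); field.
apply: DeriveDef; last exact: cvg_lim.
by apply/cvg_ex; exists d.
Qed.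

Lemma is_derive_sqrtX (j : nat) y :
  is_derive y (1 : R) (fun t => Num.sqrt t ^+ j.+3) (j.+3%:R / 2 * Num.sqrt y ^+ j.+1).
Proof.
have [y0|y0|->] := ltgtP y 0.
- rewrite (ler0_sqrtr (ltW y0)) expr0n mulr0; apply: littleo_is_derive => e e0.
  exists (- y); first by rewrite oppr_gt0.
  move=> h _; rewrite ltr_norml => /andP[_ hy].
  rewrite !ler0_sqrtr; [|lra..].
  by rewrite expr0n subrr mul0r subrr normr0 mulr_ge0// ltW.
- have ? := is_derive1_sqrt y0.
  have s0 : 0 < Num.sqrt y by rewrite sqrtr_gt0.
  have -> : (fun t : R => Num.sqrt t ^+ j.+3) = Num.sqrt ^+ j.+3.
    by apply/funext => t; rewrite exprfctE.
  apply: (is_derive_eq (is_deriveX j.+3 _)); rewrite /GRing.scale /=.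
  by rewrite (exprS _ j.+1); field; rewrite gt_eqF.
- rewrite sqrtr0 expr0n mulr0; apply: littleo_is_derive => e e0.
  (* For [0 <= h] below this radius, [sqrt h <= e] and [sqrt h ^ j <= 1], so
     [sqrt h ^ (j + 3) <= e * h]. *)
  exists (Num.min 1 (e ^+ 2)); first by rewrite lt_min ltr01 exprn_gt0.
  move=> h _; rewrite lt_min => /andP[h1 he].
  rewrite add0r sqrtr0 expr0n subr0 mul0r subr0.
  have [h0|/ltW h0] := leP h 0.
    by rewrite ler0_sqrtr// expr0n normr0 mulr_ge0// ltW.
  move: h1 he; rewrite ger0_norm ?exprn_ge0 ?sqrtr_ge0// ger0_norm// => h1 he.
  have se : Num.sqrt h <= e.
    by rewrite -[leRHS](ger0_norm (ltW e0)) -sqrtr_sqr ler_sqrt ?sqr_ge0 ?ltW.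
  have s1 : Num.sqrt h ^+ j <= 1.
    by apply: exprn_ile1; rewrite ?sqrtr_ge0// -(@sqrtr1 R) ler_sqrt// ltW.
  rewrite -[in leRHS](sqr_sqrtr h0) 3!exprS expr2.
  have := sqrtr_ge0 h; set s := Num.sqrt h in se s1 *; move=> s0.
  have sj0 : 0 <= s ^+ j by rewrite exprn_ge0.
  have -> : s * (s * (s * s ^+ j)) = (s * s ^+ j) * (s * s) by ring.
  apply: ler_wpM2r; first exact: mulr_ge0.
  by apply: le_trans se; rewrite ler_piMr.
Qed.

Lemma continuous_sqrtX (j : nat) : continuous (fun t : R => Num.sqrt t ^+ j).
Proof.
move=> t; apply: (@continuous_comp _ _ _ Num.sqrt (fun t => t ^+ j)).
  exact: sqrt_continuous.
exact: exprn_continuous.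
Qed.

Lemma powR_half (n : nat) t : 0 <= t -> t `^ (n.+1%:R / 2) = Num.sqrt t ^+ n.+1.
Proof.
move=> t0; rewrite mulrC powRrM powR12_sqrt// powR_mulrn// sqrtr_ge0.
Qed.
End SqrtPower.

Section Profile.
Variables (R : realType) (m : nat).
Implicit Types (x y t : R).
Local Notation b := (m.+4.+1).

Definition profile y : R := Num.sqrt y ^+ b.
Definition slope y : R := b%:R / 2 * Num.sqrt y ^+ m.+3.
Definition slope' y : R := b%:R / 2 * (m.+3%:R / 2 * Num.sqrt y ^+ m.+1).
Definition speed y : R := Num.sqrt (1 + slope y ^+ 2).
Definition sine y : R := slope y / speed y.
Definition sine' y : R := slope' y / speed y ^+ 3.
(* The third coordinate of the curves, [y ^+ (2 * b + 1) / (2 * b + 1)] for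
   [y <= 0] and [0] for [0 <= y], written with [y = - (sqrt (- y)) ^ 2]. *)
Definition height y : R := - (Num.sqrt (- y) ^+ (4 * m + 22) / (2 * m + 11)%:R).
(* [P ^ 2] minus its value on the curve at the same height [x2 = y]. *)
Definition defect x y : R := (x ^+ 2 - y ^+ b) ^+ 2 - Num.sqrt (- y) ^+ (4 * m + 20).
(* A Lipschitz function comparable to [Num.sqrt (defect x y)]. *)
Definition gauge x y : R := `| `|x| - profile y | * (`|x| + profile y + profile (- y)).

Lemma profile_ge0 y : 0 <= profile y.
Proof. by rewrite exprn_ge0// sqrtr_ge0. Qed.

Lemma profile_le0 y : y <= 0 -> profile y = 0.
Proof. by move=> y0; rewrite /profile ler0_sqrtr// expr0n. Qed.

Lemma is_derive_profile y : is_derive y (1 : R) profile (slope y).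
Proof. exact: is_derive_sqrtX. Qed.

Lemma is_derive_slope y : is_derive y (1 : R) slope (slope' y).
Proof. by apply: is_deriveZ; exact: is_derive_sqrtX. Qed.

Lemma is_derive_height y : is_derive y (1 : R) height (Num.sqrt (- y) ^+ (4 * m + 20)).
Proof.
have dN : is_derive y (1 : R) (fun t => - t) (-1) by exact: is_deriveNid.
have d1 := @is_derive1_comp R (fun t => Num.sqrt t ^+ (4 * m + 19).+3) (fun t => - t) y _ _
  (is_derive_sqrtX (4 * m + 19) (- y)) dN.
have -> : height = (fun t => (- (2 * m + 11)%:R^-1) *
    ((fun t => Num.sqrt t ^+ (4 * m + 19).+3) \o (fun t => - t)) t).
  apply/funext => t; rewrite /height /= mulrC -mulNr; congr (_ * _ ^+ _).
    lia.
have d2 := is_deriveZ (- (2 * m + 11)%:R^-1) d1.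
apply: is_derive_eq; rewrite /GRing.scale /=.
have -> : (4 * m + 20 = (4 * m + 19).+1)%N by lia.
have -> : (4 * m + 19).+3%:R = 2 * (2 * m + 11)%:R :> R.
  by rewrite -natrM; congr (_ %:R); lia.
have : (2 * m + 11)%:R != 0 :> R by rewrite pnatr_eq0; lia.
by set D := (2 * m + 11)%:R => D0; field.
Qed.

Lemma speed_gt0 y : 0 < speed y.
Proof. by rewrite sqrtr_gt0 ltr_wpDr// sqr_ge0. Qed.

Lemma speed_sqr y : speed y ^+ 2 = 1 + slope y ^+ 2.
Proof. by rewrite sqr_sqrtr// addr_ge0// sqr_ge0. Qed.

Lemma slope_ge0 y : 0 <= slope y.
Proof. by rewrite mulr_ge0 ?divr_ge0// exprn_ge0// sqrtr_ge0. Qed.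

Lemma slope'_ge0 y : 0 <= slope' y.
Proof. by rewrite !mulr_ge0 ?divr_ge0// exprn_ge0// sqrtr_ge0. Qed.

Lemma is_derive_sine y : is_derive y (1 : R) sine (sine' y).
Proof.
have s0 : 0 < 1 + slope y ^+ 2 by rewrite ltr_wpDr// sqr_ge0.
have dS := is_derive_slope y.
have dq : is_derive y (1 : R) (fun t => 1 + slope t ^+ 2) (2 * slope y * slope' y).
  apply: is_derive_eq; rewrite /GRing.scale /=.
    by ring.
have dW : is_derive y (1 : R) speed ((2 * speed y)^-1 * (2 * slope y * slope' y)).
  have dsq := is_derive1_sqrt s0.
  exact: (@is_derive1_comp R Num.sqrt (fun t => 1 + slope t ^+ 2)).
have W0 : speed y != 0 by rewrite gt_eqF ?speed_gt0.
have dV := is_deriveV W0 dW.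
have dM := is_deriveM dS dV.
apply: (is_derive_eq dM); rewrite /GRing.scale /= /sine'.
have -> : slope' y / speed y ^+ 3 = slope' y * (speed y ^+ 2 - slope y ^+ 2) / speed y ^+ 3.
  by rewrite speed_sqr addrK mulr1.
by field.
Qed.

Lemma continuous_slope : continuous slope.
Proof. exact: is_derive_continuous is_derive_slope. Qed.

Lemma continuous_slope' : continuous slope'.
Proof.
move=> t; do 2 (apply: cvgM; first exact: cvg_cst).
exact: continuous_sqrtX.
Qed.

Lemma continuous_speed : continuous speed.
Proof.
move=> t; apply: (@continuous_comp _ _ _ (fun t => 1 + slope t ^+ 2) Num.sqrt).
  apply: continuousD; first exact: cvg_cst.
  apply: (@continuous_comp _ _ _ slope (fun t => t ^+ 2)); last exact: exprn_continuous.
  exact: continuous_slope.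
exact: sqrt_continuous.
Qed.

Lemma continuous_sine' : continuous sine'.
Proof.
move=> t; apply: continuousM; first exact: continuous_slope'.
apply: continuousV; first by rewrite expf_neq0// gt_eqF ?speed_gt0.
apply: (@continuous_comp _ _ _ speed (fun t => t ^+ 3)); last exact: exprn_continuous.
exact: continuous_speed.
Qed.

Lemma speed_ge1 y : 1 <= speed y.
Proof. by rewrite -[leLHS]sqrtr1 ler_sqrt ?lerDl ?sqr_ge0// addr_ge0// sqr_ge0. Qed.

Lemma sine_ge0 y : 0 <= sine y.
Proof. by rewrite divr_ge0 ?slope_ge0// ltW// speed_gt0. Qed.

Lemma sine_le_slope y : sine y <= slope y.
Proof. by rewrite ler_pdivrMr ?speed_gt0// ler_peMr ?slope_ge0// speed_ge1. Qed.

Lemma sine'_ge0 y : 0 <= sine' y.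
Proof. by rewrite divr_ge0 ?slope'_ge0// exprn_ge0// ltW// speed_gt0. Qed.

Lemma sine'_le y : sine' y <= b%:R ^+ 2 * Num.sqrt y ^+ m.+1.
Proof.
apply: (@le_trans _ _ (slope' y)).
  rewrite ler_pdivrMr ?exprn_gt0 ?speed_gt0// ler_peMr ?slope'_ge0//.
  by rewrite exprn_ege1// speed_ge1.
rewrite /slope' mulrA ler_wpM2r ?exprn_ge0 ?sqrtr_ge0//.
have : (m.+3%:R : R) <= b%:R by rewrite ler_nat; lia.
have : (0 : R) <= m.+3%:R by [].
by nra.
Qed.

(** Identifies the coefficient of [Y] in the derivative of [S] below with the second component of
    the unit tangent. *)
Lemma speed_sine y : speed y - slope y * sine y = (speed y)^-1.
Proof.
have W0 : speed y != 0 by rewrite gt_eqF ?speed_gt0.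
apply: (mulfI W0); rewrite divff// mulrBr -expr2 speed_sqr.
by rewrite /sine; field.
Qed.

Lemma profileM0 y : profile y * profile (- y) = 0.
Proof.
have [y0|/ltW y0] := leP y 0; first by rewrite profile_le0// mul0r.
by rewrite (@profile_le0 (- y)) ?mulr0// oppr_le0.
Qed.

Hypothesis modd : ~~ odd m.

(** As [b] is odd, that is [m] even, the squares of [profile y] and [profile (- y)] are the positive
    and negative parts of [y ^ b]. *)
Lemma odd_power y : y ^+ b = profile y ^+ 2 - profile (- y) ^+ 2.
Proof.
rewrite /profile -!exprM mulnC !exprM.
have [y0|/ltW y0] := leP y 0.
  rewrite (ler0_sqrtr y0) sqr_sqrtr ?oppr_ge0// expr0n expr0n sub0r.
  by rewrite exprNn -signr_odd /= !negbK (negbTE modd) expr1 mulN1r opprK.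
by rewrite sqr_sqrtr// (@ler0_sqrtr _ (- y)) ?oppr_le0// expr0n expr0n subr0.
Qed.

Lemma sqrtN_power y : Num.sqrt (- y) ^+ (4 * m + 20) = profile (- y) ^+ 4.
Proof. by rewrite /profile -exprM; congr (_ ^+ _); lia. Qed.

Lemma defectE x y : defect x y =
  (x ^+ 2 - profile y ^+ 2 + profile (- y) ^+ 2) ^+ 2 - profile (- y) ^+ 4.
Proof. by rewrite /defect sqrtN_power odd_power opprB addrA addrAC. Qed.

Lemma defect_ge0 x y : 0 <= defect x y.
Proof.
rewrite defectE; have /eqP := profileM0 y; rewrite mulf_eq0 => /orP[/eqP ->|/eqP ->].
  by have := sqr_ge0 x; have := sqr_ge0 (profile (- y)); nra.
by rewrite expr0n addr0 expr0n subr0 sqr_ge0.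
Qed.

(** One of [A = profile y] and [B = profile (- y)] vanishes. If [B = 0], the defect is the square of
    the gauge; if [A = 0], the comparison is between [u ^ 2 (u ^ 2 + 2 B ^ 2)] and
    [u ^ 2 (u + B) ^ 2], where [u = |x|]. *)
Lemma gauge_defect x y : gauge x y ^+ 2 <= 2 * defect x y /\ defect x y <= 2 * gauge x y ^+ 2.
Proof.
rewrite defectE /gauge exprMn real_normK ?num_real//.
rewrite -(real_normK (num_real x)); have := normr_ge0 x; set u := `|x| => u0.
have := profile_ge0 y; have := profile_ge0 (- y).
have /eqP := profileM0 y; rewrite mulf_eq0 => /orP[/eqP ->|/eqP ->].
  set B := profile _ => B0 _.
  have := mulr_ge0 u0 B0; have := sqr_ge0 (u ^+ 2); have := sqr_ge0 (u * B).
  have := sqr_ge0 (u * (u - B)).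
  have := mulr_ge0 (mulr_ge0 u0 B0) (sqr_ge0 u).
  by split; nra.
set A := profile _ => _ A0.
rewrite expr0n !addr0 expr0n subr0.
have -> : (u - A) ^+ 2 * (u + A) ^+ 2 = (u ^+ 2 - A ^+ 2) ^+ 2 by ring.
by have := sqr_ge0 (u ^+ 2 - A ^+ 2); split; lra.
Qed.
End Profile.

(** * Estimates on the profile, the gain and the gauge *)

Section Estimates.
Variables (R : realType) (m : nat).
Implicit Types (x y t r rho : R).
Local Notation b := (m.+4.+1).

(** Subtracting 1 makes the integrand vanish for [y <= 0], hence integrable from minus infinity,
    which yields a single primitive on the whole line. *)
Lemma speed_primitive : exists Lam : R -> R, forall y, is_derive y (1 : R) Lam (speed m y).
Proof.
pose g y : R := speed m y - 1.
have cg : continuous g.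
  by move=> t; apply: cvgB; [exact: continuous_speed|exact: cvg_cst].
have g0 y : y <= 0 -> g y = 0.
  by move=> y0; rewrite /g /speed /slope (ler0_sqrtr y0) expr0n mulr0 expr0n addr0 sqrtr1 subrr.
have ig u : (@lebesgue_measure R).-integrable `]-oo, u] (EFin \o g).
  have : (@lebesgue_measure R).-integrable `[0, `|u|] (EFin \o g).
    apply: continuous_compact_integrable; first exact: segment_compact.
    exact: continuous_subspaceT.
  move=> /integrable_mkcond => /(_ (measurable_itv _)) ig.
  apply: eq_integrable (integrableS _ _ _ ig) => // y.
  rewrite inE/= in_itv/= => yu; rewrite patchE; case: ifPn => //.
  rewrite notin_setE => /=.
  have [y0 _|y0] := leP y 0; first by rewrite g0.
  by case; rewrite in_itv/= (ltW y0) (le_trans yu)// ler_norm.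
exists (fun y => y + \int[@lebesgue_measure R]_(t in `]-oo, y]) g t) => y.
have yu : y < y + 1 by rewrite ltrDl.
have [dG GE] := continuous_FTC1 yu (ig _) (ltNyr _) (cg y).
have := derivableP dG; rewrite -derive1E GE => dG'.
by apply: is_derive_eq; rewrite /g addrC subrK.
Qed.

(** For [r <= 1] the last term is at least 1 and covers [X <= 1], while for [X >= 1] the first term
    is at least [X]. For [r >= 1] the right side dominates [(2 a X) ^ 2 + r ^ (-4)], and the
    inequality of means bounds this below by [4 r ^ (n + 3) X]. *)
Lemma gain_scaled (n : nat) (X r : R) : 0 <= X -> 0 <= r ->
  r ^+ n.+1 * X <= X ^+ 2 * (X + 2 * (r ^+ n.+1 * r ^+ 4)) ^+ 2 + 2 / (1 + r ^+ 4).
Proof.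
move=> X0 r0; have rn0 : 0 <= r ^+ n.+1 by rewrite exprn_ge0.
have r40 : 0 <= r ^+ 4 by rewrite exprn_ge0.
have D0 : 0 <= 2 / (1 + r ^+ 4) by rewrite divr_ge0// addr_ge0.
set a := r ^+ n.+1 * r ^+ 4; have a0 : 0 <= a by rewrite mulr_ge0.
have [r1|/ltW r1] := leP r 1.
  have rn1 : r ^+ n.+1 <= 1 by rewrite exprn_ile1.
  have rX : r ^+ n.+1 * X <= X by rewrite ler_piMl.
  have r41 : r ^+ 4 <= 1 by rewrite exprn_ile1.
  have [X1|/ltW X1] := leP X 1.
    have D1 : 1 <= 2 / (1 + r ^+ 4) by rewrite ler_pdivlMr; lra.
    have : 0 <= X ^+ 2 * (X + 2 * a) ^+ 2 by rewrite mulr_ge0 ?sqr_ge0.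
    by lra.
  have H1 : 1 <= X ^+ 2 by rewrite exprn_ege1.
  have H2 : 1 <= (X + 2 * a) ^+ 2 by rewrite exprn_ege1//; lra.
  have H3 : X <= X ^+ 2 by rewrite expr2 ler_peMr.
  have : X ^+ 2 <= X ^+ 2 * (X + 2 * a) ^+ 2 by rewrite ler_peMr ?sqr_ge0.
  by lra.
have i0 : 0 < r ^+ 2 by rewrite exprn_gt0//; lra.
have i1 : 1 <= r ^+ 2 by rewrite exprn_ege1.
have D1 : (r ^+ 2)^-1 ^+ 2 <= 2 / (1 + r ^+ 4).
  have -> : (r ^+ 2)^-1 ^+ 2 = 2 / (2 * r ^+ 4).
    have r00 : r != 0 by rewrite gt_eqF//; lra.
    by rewrite exprVn -exprM; field.
  have : 1 <= r ^+ 4 by rewrite exprn_ege1.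
  by move=> ?; rewrite ler_wpM2l// lef_pV2 ?posrE; lra.
have H1 : 4 * a ^+ 2 * X ^+ 2 <= X ^+ 2 * (X + 2 * a) ^+ 2.
  have := mulr_ge0 X0 a0; have := sqr_ge0 X; nra.
have aE : a * (r ^+ 2)^-1 = r ^+ n.+1 * r ^+ 2.
  by rewrite /a; field; rewrite gt_eqF//; lra.
have : 0 <= (2 * (a * X) - (r ^+ 2)^-1) ^+ 2 by exact: sqr_ge0.
have -> : (2 * (a * X) - (r ^+ 2)^-1) ^+ 2 =
  4 * a ^+ 2 * X ^+ 2 + (r ^+ 2)^-1 ^+ 2 - 4 * (a * (r ^+ 2)^-1 * X) by ring.
rewrite aE; have := mulr_ge0 rn0 X0; set q := r ^+ n.+1 * X => q0.
have -> : r ^+ n.+1 * r ^+ 2 * X = q * r ^+ 2 by rewrite /q; ring.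
have : q <= q * r ^+ 2 by rewrite ler_peMr.
by lra.
Qed.

Hypothesis modd : ~~ odd m.

(* Scaling [y = rho ^ 2 r ^ 2], [x - profile y = rho ^ b X] reduces this to [gain_scaled]. *)
Lemma gain_le_defect rho x y : 0 < rho ->
  (x - profile m y) * Num.sqrt y ^+ m.+1 <=
  defect m x y / rho ^+ (2 * m + 14) + 2 * rho ^+ (2 * m + 10) / (rho ^+ 4 + y ^+ 2).
Proof.
move=> rho0.
have R0 : 0 <= defect m x y / rho ^+ (2 * m + 14).
  by rewrite divr_ge0 ?defect_ge0// exprn_ge0// ltW.
have R1 : 0 <= 2 * rho ^+ (2 * m + 10) / (rho ^+ 4 + y ^+ 2).
  by rewrite divr_ge0 ?mulr_ge0 ?addr_ge0 ?sqr_ge0// exprn_ge0// ltW.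
have [y0|y0] := leP y 0.
  by rewrite ler0_sqrtr// expr0n mulr0 addr_ge0.
have s0 : 0 < Num.sqrt y by rewrite sqrtr_gt0.
have [h0|/ltW h0] := leP (x - profile m y) 0.
  by apply: (@le_trans _ _ 0); [rewrite mulr_le0_ge0// exprn_ge0// ltW|exact: addr_ge0].
have yE : y = Num.sqrt y ^+ 2 by rewrite sqr_sqrtr// ltW.
have dE : defect m x y = (x - profile m y) ^+ 2 * (x - profile m y + 2 * profile m y) ^+ 2.
  rewrite defectE// (@profile_le0 _ m (- y)) ?oppr_le0 ?ltW// expr0n addr0 expr0n subr0.
  by ring.
rewrite dE {R0 R1 dE} [in rho ^+ 4 + y ^+ 2]yE.
have fE : profile m y = Num.sqrt y ^+ m.+1 * Num.sqrt y ^+ 4.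
  by rewrite /profile -exprD; congr (_ ^+ _); lia.
move: fE h0 s0; set f := profile m y; set h := x - f; set s := Num.sqrt y => fE h0 s0.
have X0 : 0 <= h / rho ^+ b by rewrite divr_ge0// exprn_ge0// ltW.
have r0 : 0 <= s / rho by rewrite divr_ge0// ltW.
have := @gain_scaled m _ _ X0 r0.
have p0 : 0 < rho ^+ (2 * m + 6) by rewrite exprn_gt0.
rewrite -(ler_pM2r p0) => H.
have E1 : (s / rho) ^+ m.+1 * (h / rho ^+ b) * rho ^+ (2 * m + 6) = h * s ^+ m.+1.
  have -> : rho ^+ (2 * m + 6) = rho ^+ m.+1 * rho ^+ b.
    by rewrite -exprD; congr (_ ^+ _); ring.
  by rewrite expr_div_n; field; rewrite !expf_neq0// gt_eqF.
rewrite -E1; apply: (le_trans H); rewrite mulrDl.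
have rho00 : rho != 0 by rewrite gt_eqF.
rewrite le_eqVlt; apply/orP; left; apply/eqP; congr (_ + _).
  have -> : rho ^+ (2 * m + 14) = (rho ^+ b) ^+ 4 / rho ^+ (2 * m + 6).
    rewrite -exprM; apply: (canRL (mulfK _)); first by rewrite expf_neq0.
    by rewrite -exprD; congr (_ ^+ _); ring.
  have -> : (s / rho) ^+ m.+1 * (s / rho) ^+ 4 = f / rho ^+ b.
    rewrite -exprD expr_div_n fE -exprD.
    by have -> : (m.+1 + 4 = b)%N by ring.
  by field; rewrite !expf_neq0.
have -> : rho ^+ (2 * m + 10) = rho ^+ (2 * m + 6) * rho ^+ 4.
  by rewrite -exprD; congr (_ ^+ _); ring.
have s4 : 0 < rho ^+ 4 + (s ^+ 2) ^+ 2 by rewrite addr_gt0// exprn_gt0// exprn_gt0.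
have -> : 1 + (s / rho) ^+ 4 = (rho ^+ 4 + (s ^+ 2) ^+ 2) / rho ^+ 4.
  by rewrite expr_div_n -exprM mulrDl divff// expf_neq0.
by rewrite invf_div; ring.
Qed.

Lemma profile_le_norm y : `|y| <= 1 -> profile m y <= `|y|.
Proof.
move=> y1; have [y0|/ltW y0] := leP y 0; first by rewrite profile_le0.
rewrite ger0_norm// in y1 *; rewrite -[leRHS](sqr_sqrtr y0).
apply: ler_wiXn2l; rewrite ?sqrtr_ge0//.
by rewrite -(@sqrtr1 R) ler_sqrt.
Qed.

Lemma sqrt_le1 y : `|y| <= 1 -> Num.sqrt y <= 1.
Proof.
by move=> y1; rewrite -(@sqrtr1 R) ler_sqrt// (le_trans _ y1)// ler_norm.
Qed.

Lemma slope_le y : `|y| <= 1 -> slope m y <= b%:R / 2 * `|y|.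
Proof.
move=> y1; rewrite /slope ler_wpM2l//.
have [y0|/ltW y0] := leP y 0; first by rewrite ler0_sqrtr// expr0n normr_ge0.
rewrite ger0_norm// -[leRHS](sqr_sqrtr y0).
by apply: ler_wiXn2l; rewrite ?sqrtr_ge0// sqrt_le1.
Qed.

(** On the unit box the two factors of the gauge are at most 1 and 3 and vary by at most
    [dx + b dy / 2] and [dx + b dy], with [dx] and [dy] the distances of the arguments; the product
    rule then allows [4 b]. *)
Lemma gauge_lipschitz x x' y y' : `|x| <= 1 -> `|x'| <= 1 -> `|y| <= 1 -> `|y'| <= 1 ->
  gauge m x y <= gauge m x' y' + 4 * b%:R * (`|x - x'| + `|y - y'|).
Proof.
move=> x1 x'1 y1 y'1.
have sl t : `|t| <= 1 -> `|slope m t| <= b%:R / 2.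
  move=> t1; rewrite ger0_norm ?slope_ge0//; apply: (le_trans (slope_le t1)).
  by rewrite ler_piMr.
have fl := is_derive_bound (@is_derive_profile R m) sl.
have d1 := fl _ _ y'1 y1.
have d2 : `|profile m (- y) - profile m (- y')| <= b%:R / 2 * `|y - y'|.
  have := fl (- y') (- y); rewrite !normrN => /(_ y'1 y1).
  by rewrite -opprD normrN.
have f1 t : `|t| <= 1 -> 0 <= profile m t <= 1.
  by move=> t1; rewrite profile_ge0 (le_trans (profile_le_norm t1)).
have := f1 _ y1; have := f1 _ y'1; have := f1 (- y); have := f1 (- y').
rewrite !normrN => /(_ y'1) + /(_ y1).
move: d1 d2; rewrite /gauge.
set A := profile m y; set A' := profile m y'; set B := profile m (- y); set B' := profile m (- y').
have := ler_dist_dist x x'.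
have b1 : (1 : R) <= b%:R by rewrite ler1n.
move: x1 x'1 b1; set u := `|x|; set u' := `|x'|; set dx := `|x - x'|; set dy := `|y - y'|.
set be := (b%:R : R).
have : 0 <= u by exact: normr_ge0.
have : 0 <= u' by exact: normr_ge0.
have : 0 <= dx by exact: normr_ge0.
have : 0 <= dy by exact: normr_ge0.
move=> dy0 dx0 u'0 u0 u1 u'1 b1 du dA dB /andP[B'0 B'1] /andP[B0 B1] /andP[A'0 A'1] /andP[A0 A1].
have bdy : 0 <= be * dy by rewrite mulr_ge0//; lra.
have bdx : dx <= be * dx by rewrite ler_peMl.
have dU : `|u - A| <= `|u' - A'| + (dx + be / 2 * dy).
  have -> : u - A = (u' - A') + ((u - u') - (A - A')) by ring.
  apply: (le_trans (ler_normD _ _)); rewrite lerD2l.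
  by apply: (le_trans (ler_normB _ _)); exact: lerD.
have dV : u + A + B <= u' + A' + B' + (dx + be * dy).
  by move: du dA dB => /ler_normlP[_ ?] /ler_normlP[_ ?] /ler_normlP[_ ?]; lra.
have U'1 : `|u' - A'| <= 1 by rewrite ler_norml; lra.
have U'0 := normr_ge0 (u' - A').
apply: (@le_trans _ _ ((`|u' - A'| + (dx + be / 2 * dy)) * (u + A + B))).
  by apply: ler_wpM2r => //; lra.
rewrite mulrDl.
have H1 : `|u' - A'| * (u + A + B) <= `|u' - A'| * (u' + A' + B') + (dx + be * dy).
  apply: (@le_trans _ _ (`|u' - A'| * (u' + A' + B' + (dx + be * dy)))); first exact: ler_wpM2l.
  by rewrite mulrDr lerD2l ler_piMl//; lra.
have H2 : (dx + be / 2 * dy) * (u + A + B) <= (dx + be / 2 * dy) * 3.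
  apply: ler_wpM2l; first by rewrite addr_ge0// mulrAC divr_ge0.
  by clear -A'0 A'1 u1 A1 B1; lra.
by clear -H1 H2 bdx bdy dx0; lra.
Qed.
End Estimates.

(** * Excess and gain *)

Section Excess.
Variables (R : realType) (m : nat).
Implicit Types (x y X Y : R).
Local Notation b := (m.+4.+1).

(* The excess of the length element over its calibration by the unit tangent
   [(sine y, (speed y)^-1)] of the profile. *)
Definition excess y X Y : R :=
  Num.sqrt (X ^+ 2 + Y ^+ 2) - sine m y * X - (speed m y)^-1 * Y.

Lemma norm_le_speed X Y :
  `|X| <= Num.sqrt (X ^+ 2 + Y ^+ 2) /\ `|Y| <= Num.sqrt (X ^+ 2 + Y ^+ 2).
Proof.
by split; rewrite -sqrtr_sqr ler_sqrt ?addr_ge0 ?sqr_ge0// ?lerDl ?lerDr sqr_ge0.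
Qed.

(** Cauchy-Schwarz, the calibrating vector having length 1. *)
Lemma excess_ge0 y X Y : 0 <= excess y X Y.
Proof.
rewrite /excess; set c := (speed m y)^-1.
have sc : sine m y ^+ 2 + c ^+ 2 = 1.
  rewrite /sine -/c exprMn -{2}(mul1r (c ^+ 2)) -mulrDl addrC -speed_sqr -exprMn.
  by rewrite divff ?expr1n// gt_eqF// speed_gt0.
suff : sine m y * X + c * Y <= Num.sqrt (X ^+ 2 + Y ^+ 2) by lra.
apply: (le_trans (ler_norm _)); rewrite -sqrtr_sqr ler_sqrt ?addr_ge0 ?sqr_ge0//.
have -> : X ^+ 2 + Y ^+ 2 = (sine m y ^+ 2 + c ^+ 2) * (X ^+ 2 + Y ^+ 2).
  by rewrite sc mul1r.
have := sqr_ge0 (sine m y * Y - c * X); lra.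
Qed.

(** The length element is at least the mean of [|X|] and [|Y|]. For [Y < 0] the calibration takes
    away at most [|X| / 2], so [|Y| / 2] remains in the excess. *)
Lemma excess_bounds y X Y : sine m y <= 2^-1 ->
  [/\ `|Y| <= Y + 4 * excess y X Y, `|X| <= 2 * excess y X Y + 2 * `|Y| &
      Y < 0 -> `|Y| <= 2 * excess y X Y].
Proof.
move=> s2; have s0 := sine_ge0 m y; have e0 := excess_ge0 y X Y.
have c1 : (speed m y)^-1 <= 1 by rewrite invf_le1 ?speed_gt0// speed_ge1.
have c0 : 0 <= (speed m y)^-1 by rewrite invr_ge0 ltW// speed_gt0.
have [wX wY] := norm_le_speed X Y.
have sX : sine m y * X <= 2^-1 * `|X|.
  apply: (le_trans (ler_norm _)); rewrite normrM ger0_norm//.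
  exact: ler_wpM2r.
have cY : (speed m y)^-1 * Y <= `|Y|.
  apply: (le_trans (ler_norm _)); rewrite normrM ger0_norm//.
  exact: ler_piMl.
have neg : Y < 0 -> `|Y| <= 2 * excess y X Y.
  move=> Y0; have : (speed m y)^-1 * Y <= 0 by rewrite mulr_ge0_le0// ltW.
  by rewrite /excess; lra.
split=> //.
- have [Y0|Y0] := ltP Y 0.
    by have := neg Y0; clear neg; rewrite (ltr0_norm Y0); lra.
  by clear neg; rewrite ger0_norm//; lra.
- by clear neg; rewrite /excess; lra.
Qed.

Hypothesis modd : ~~ odd m.

(* [x - profile y] times [sine' y] is the first-order gain of length of a
   competitor; for [Y < 0] the bound is absorbed by the excess. *)
Lemma gain_velocity rho x y X Y (h0 M : R) : 0 < rho -> sine m y <= 2^-1 ->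
  `|(x - profile m y) * sine' m y| <= h0 -> defect m x y <= M ->
  (x - profile m y) * sine' m y * Y <=
    b%:R ^+ 2 / rho ^+ (2 * m + 14) * (defect m x y * Y) +
    b%:R ^+ 2 * (2 * rho ^+ (2 * m + 10) / (rho ^+ 4 + y ^+ 2) * Y) +
    2 * (h0 + b%:R ^+ 2 / rho ^+ (2 * m + 14) * M + b%:R ^+ 2 * (2 * rho ^+ (2 * m + 6)))
      * excess y X Y.
Proof.
move=> rho0 s2 hk dM.
have [_ _ neg] := excess_bounds X Y s2; have e0 := excess_ge0 y X Y.
have k0 : 0 <= b%:R ^+ 2 :> R by exact: sqr_ge0.
set lam := b%:R ^+ 2 / rho ^+ (2 * m + 14).
have lam0 : 0 <= lam by rewrite divr_ge0// exprn_ge0// ltW.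
have d0 := defect_ge0 modd x y.
set m0 := 2 * rho ^+ (2 * m + 10) / (rho ^+ 4 + y ^+ 2).
have m00 : 0 <= m0 by rewrite divr_ge0 ?mulr_ge0 ?addr_ge0 ?sqr_ge0// exprn_ge0// ltW.
have mM : m0 <= 2 * rho ^+ (2 * m + 6).
  rewrite /m0 ler_pdivrMr; last by rewrite ltr_wpDr ?sqr_ge0// exprn_gt0.
  have -> : rho ^+ (2 * m + 10) = rho ^+ (2 * m + 6) * rho ^+ 4.
    by rewrite -exprD; congr (_ ^+ _); ring.
  have p0 : 0 <= rho ^+ (2 * m + 6) * y ^+ 2 by rewrite mulr_ge0 ?sqr_ge0// exprn_ge0// ltW.
  by move: p0; set p := rho ^+ (2 * m + 6); lra.
have h00 : 0 <= h0 by exact: le_trans hk.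
have A0 : 0 <= lam * M by rewrite mulr_ge0//; exact: le_trans dM.
have B0 : 0 <= b%:R ^+ 2 * (2 * rho ^+ (2 * m + 6)) :> R.
  by rewrite !mulr_ge0// exprn_ge0// ltW.
have gain : (x - profile m y) * sine' m y <= lam * defect m x y + b%:R ^+ 2 * m0.
  have := gain_le_defect modd x y rho0; rewrite -/m0 => g.
  have -> : lam * defect m x y + b%:R ^+ 2 * m0 =
     b%:R ^+ 2 * (defect m x y / rho ^+ (2 * m + 14) + m0) by rewrite /lam; ring.
  have [h1|/ltW h1] := leP (x - profile m y) 0.
    apply: (@le_trans _ _ 0); first by rewrite mulr_le0_ge0// sine'_ge0.
    by rewrite mulr_ge0// addr_ge0// divr_ge0// exprn_ge0// ltW.
  apply: le_trans (ler_wpM2l k0 g); rewrite [leRHS]mulrCA.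
  by apply: ler_wpM2l => //; exact: sine'_le.
have [Y0|Y0] := leP 0 Y.
  apply: (le_trans (ler_wpM2r Y0 gain)).
  have -> : (lam * defect m x y + b%:R ^+ 2 * m0) * Y =
    lam * (defect m x y * Y) + b%:R ^+ 2 * (m0 * Y) by ring.
  rewrite lerDl.
  by rewrite mulr_ge0// mulr_ge0// !addr_ge0.
(* For [Y < 0] the first two terms on the right change sign; all three coefficients are replaced by
   upper bounds and [|Y|] by twice the excess. *)
have nY : `|Y| = - Y by rewrite ltr0_norm.
set S := h0 + _ + _.
have H1 : (x - profile m y) * sine' m y * Y <= h0 * `|Y|.
  by apply: (le_trans (ler_norm _)); rewrite normrM ler_wpM2r.
have H2 : - (lam * (defect m x y * Y)) <= lam * M * `|Y|.
  by rewrite nY mulrN -(mulrA lam) lerN2 ler_wpM2l// ler_wnM2r// ltW.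
have H3 : - (b%:R ^+ 2 * (m0 * Y)) <= b%:R ^+ 2 * (2 * rho ^+ (2 * m + 6)) * `|Y|.
  by rewrite nY mulrN -(mulrA (b%:R ^+ 2)) lerN2 ler_wpM2l// ler_wnM2r// ltW.
have H4 : S * `|Y| <= S * (2 * excess y X Y).
  by apply: ler_wpM2l; [rewrite /S !addr_ge0|exact: neg].
by move: H4; rewrite /S; lra.
Qed.

(* On the last stretch before a point of maximal gauge on which the gauge is at
   least half of its maximum, [defect * |Y|] controls [|X| + |Y|]. *)
Lemma variation_le_defect x y X Y (g : R) : sine m y <= 2^-1 -> 0 < g ->
  g / 2 <= gauge m x y -> gauge m x y <= g ->
  `|X| + `|Y| <= 2 * excess y X Y +
     24 / g ^+ 2 * (defect m x y * Y + 8 * g ^+ 2 * excess y X Y).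
Proof.
move=> s2 g0 g1 g2; have [YY XX _] := excess_bounds X Y s2.
have e0 := excess_ge0 y X Y.
have [G1 G2] := gauge_defect modd x y.
have gg0 : 0 < g ^+ 2 by rewrite exprn_gt0.
have D1 : g ^+ 2 / 8 <= defect m x y.
  have : (g / 2) ^+ 2 <= gauge m x y ^+ 2 by rewrite ler_sqr ?nnegrE; lra.
  by rewrite expr_div_n; lra.
have D2 : defect m x y <= 2 * g ^+ 2.
  have : gauge m x y ^+ 2 <= g ^+ 2 by rewrite ler_sqr ?nnegrE; lra.
  by lra.
have D0 := defect_ge0 modd x y.
have H : g ^+ 2 / 8 * `|Y| <= defect m x y * Y + 8 * g ^+ 2 * excess y X Y.
  apply: (@le_trans _ _ (defect m x y * `|Y|)); first exact: ler_wpM2r.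
  apply: (@le_trans _ _ (defect m x y * (Y + 4 * excess y X Y))); first exact: ler_wpM2l.
  rewrite mulrDr lerD2l mulrCA.
  have : defect m x y * excess y X Y <= 2 * g ^+ 2 * excess y X Y by exact: ler_wpM2r.
  by lra.
(* Since [|X| + |Y| <= 2 excess + 3 |Y|], the factor 8 becomes the 24 of the statement. *)
have : `|Y| <= 8 / g ^+ 2 * (defect m x y * Y + 8 * g ^+ 2 * excess y X Y).
  rewrite -(@ler_pM2l _ (g ^+ 2 / 8)) ?divr_gt0//; apply: (le_trans H).
  rewrite le_eqVlt; apply/orP; left; apply/eqP; field.
  by rewrite gt_eqF.
by lra.
Qed.
End Excess.

(** * The lower bound for competitors *)

Section LowerBound.
Variables (R : realType) (m : nat).
Hypothesis modd : ~~ odd m.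
Local Notation b := (m.+4.+1).
Notation mu := (@lebesgue_measure R).

Lemma ac_derive_norm_le (a c : R) (F f G g : R -> R) :
  ac_derive a c F f -> ac_derive a c G g -> a <= c ->
  (forall t, a < t < c -> `|f t| <= g t) -> `|F c - F a| <= G c - G a.
Proof.
move=> dF dG ac fg; rewrite ler_norml; apply/andP; split.
  have gf t : a < t < c -> -1 * g t <= f t by move=> /fg; rewrite ler_norml mulN1r => /andP[].
  by have := ac_derive_le ac (ac_deriveZ (-1) dG) dF gf; lra.
by apply: (ac_derive_le ac dF dG) => t /fg; exact: le_trans (ler_norm _).
Qed.

Lemma last_crossing (a c v : R) (F : R -> R) : a <= c -> abs_cont a c F ->
  F a <= v ->
  exists t0, [/\ a <= t0, t0 <= c, F t0 <= v & forall t, t0 < t -> t <= c -> v < F t].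
Proof.
move=> ac AF Fav; pose S := [set t | a <= t <= c /\ F t <= v].
have Sa : S a by split=> //; rewrite lexx.
have ubS : ubound S c by move=> t [/andP[]].
have hsS : has_sup S by split; [exists a|exists c].
have as_ : a <= sup S by apply: ub_le_sup => //; exists c.
have sc : sup S <= c by apply: ge_sup => //; exists a.
exists (sup S); split=> //; last first.
  move=> t st tc; rewrite ltNge; apply/negP => Ft.
  have : t <= sup S.
    apply: ub_le_sup; first by exists c.
    by split=> //; rewrite tc andbT; lra.
  by lra.
rewrite leNgt; apply/negP => Fs.
have := abs_cont_clamp ac AF (x := sup S).
move=> /cvgrPdist_lt /(_ (F (sup S) - v)); rewrite subr_gt0 => /(_ Fs) [d /= d0 Hd].
have [t [tac Ft] tS] := sup_adherent d0 hsS.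
have ts : t <= sup S by apply: ub_le_sup => //; exists c.
have := Hd t; rewrite /= !clamp_id//; last by rewrite as_ sc.
rewrite ger0_norm ?subr_ge0// => /(_ _)/ltr_normlP[]; first by lra.
by lra.
Qed.

Variables (Lam : R -> R).
Hypothesis dLam : forall y, is_derive y (1 : R) Lam (speed m y).
Variables (a c : R) (x y z X Y : R -> R).
Hypothesis ac : a <= c.
Hypothesis dx : ac_derive a c x X.
Hypothesis dy : ac_derive a c y Y.
Hypothesis dz : ac_derive a c z (fun t => (x t ^+ 2 - y t ^+ b) ^+ 2 * Y t).
Hypothesis mY : measurable_fun setT Y.
Let w t := Num.sqrt (X t ^+ 2 + Y t ^+ 2).
Hypothesis iw : mu.-integrable `[a, c] (EFin \o w).

(** The calibrating function: its derivative is the calibrated length element [sine * X + Y / speed]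
    plus [gain * Y]. *)
Let S t := Lam (y t) + (x t - profile m (y t)) * sine m (y t).

Lemma dS : ac_derive a c S (fun t => speed m (y t) * Y t +
  ((X t - slope m (y t) * Y t) * sine m (y t) +
   (x t - profile m (y t)) * (sine' m (y t) * Y t))).
Proof.
apply: ac_deriveD; first exact: (ac_derive_comp ac dLam (@continuous_speed R m) dy).
apply: ac_deriveM => //.
  apply: ac_deriveB => //.
  exact: (ac_derive_comp ac (@is_derive_profile R m) (@continuous_slope R m) dy).
exact: (ac_derive_comp ac (@is_derive_sine R m) (@continuous_sine' R m) dy).
Qed.

Let gain t := (x t - profile m (y t)) * sine' m (y t).

Lemma gain_primitive : exists J, ac_derive a c J (fun t => gain t * Y t).
Proof.
pose cl t := Num.max a (Num.min c t).
have cx : continuous (fun t => x (cl t)) by exact: abs_cont_clamp (proj1 dx).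
have cy : continuous (fun t => y (cl t)) by exact: abs_cont_clamp (proj1 dy).
have [||J dJ] := @ac_derive_primitive_mul R a c (fun t => gain (cl t)) Y w ac _ mY iw.
- move=> t; apply: cvgM; first apply: cvgB; first exact: cx.
    apply: (@continuous_comp _ _ _ (fun t => y (cl t)) (profile m)); first exact: cy.
    exact: continuous_sqrtX.
  apply: (@continuous_comp _ _ _ (fun t => y (cl t)) (sine' m)); first exact: cy.
  exact: continuous_sine'.
- by move=> t; exact: (norm_le_speed _ _).2.
exists J; apply: ac_derive_eq dJ => t /andP[at_ tc].
by rewrite /cl clamp_id// !ltW.
Qed.

(** By horizontality its derivative is [defect * Y], so its equal end values ([zeta_ac]) express the
    vanishing of the integral of [Q dy]. *)
Let zeta t := z t - height m (y t).

Lemma dzeta : ac_derive a c zeta (fun t => defect m (x t) (y t) * Y t).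
Proof.
have cN : continuous (fun y : R => Num.sqrt (- y) ^+ (4 * m + 20)).
  move=> t; apply: (@continuous_comp _ _ _ (fun t : R => - t)
    (fun t => Num.sqrt t ^+ (4 * m + 20))).
    exact: opp_continuous.
  exact: continuous_sqrtX.
have := ac_deriveB dz (ac_derive_comp ac (@is_derive_height R m) cN dy).
by apply: ac_derive_eq => t _; rewrite /defect mulrBl.
Qed.

(** A primitive, along the competitor, of the second term of [gain_le_defect] times [Y]; the
    arctangent bounds its increment independently of the range of [y]. *)
Let barrier rho t := 2 * rho ^+ (2 * m + 8) * atan ((rho ^+ 2)^-1 * y t).

Lemma dbarrier rho : 0 < rho -> ac_derive a c (barrier rho)
  (fun t => 2 * rho ^+ (2 * m + 10) / (rho ^+ 4 + y t ^+ 2) * Y t).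
Proof.
move=> rho0.
have cV : continuous (fun t : R => (1 + t ^+ 2)^-1).
  move=> t; apply: cvgV; first by rewrite gt_eqF// ltr_wpDr ?sqr_ge0.
  by apply: cvgD; [exact: cvg_cst|exact: exprn_continuous].
have := ac_derive_comp ac (@is_derive1_atan R) cV (ac_deriveZ (rho ^+ 2)^-1 dy).
move=> /(ac_deriveZ (2 * rho ^+ (2 * m + 8))); apply: ac_derive_eq => t _.
have -> : rho ^+ (2 * m + 10) = rho ^+ (2 * m + 8) * rho ^+ 2.
  by rewrite -exprD; congr (_ ^+ _); lia.
have r0 : rho != 0 by rewrite gt_eqF.
have -> : 1 + ((rho ^+ 2)^-1 * y t) ^+ 2 = (rho ^+ 4 + y t ^+ 2) / rho ^+ 4 by field.
rewrite invf_div.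
have -> : rho ^+ 4 = rho ^+ 2 * rho ^+ 2 by ring.
by rewrite !mulrA; congr (_ * _); set D := (_ + _)^-1; field.
Qed.

Lemma barrier_le rho : 0 < rho -> barrier rho c - barrier rho a <= 8 * rho ^+ (2 * m + 8).
Proof.
move=> rho0; rewrite /barrier -mulrBr.
have := @atan_ltpi2 R ((rho ^+ 2)^-1 * y c); have := @atan_gtNpi2 R ((rho ^+ 2)^-1 * y a).
have := @pihalf_lt2 R => p2 H1 H2.
have -> : 8 * rho ^+ (2 * m + 8) = 2 * rho ^+ (2 * m + 8) * 4 by ring.
by apply: ler_wpM2l; [rewrite mulr_ge0// exprn_ge0// ltW|lra].
Qed.

(** * Competitors with the end points of the curve *)

Variables (eps rho0 : R).
Hypothesis eps_gt0 : 0 < eps.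
Hypothesis eps_small : 120 * b%:R ^+ 2 * eps <= 1.
Hypothesis xa : x a = 0.
Hypothesis ya : y a = - eps.
Hypothesis za : z a = height m (- eps).
Hypothesis xc : x c = profile m eps.
Hypothesis yc : y c = eps.
Hypothesis zc : z c = 0.
Let L := Lam eps - Lam (- eps).

Lemma b1 : (5 : R) <= b%:R. Proof. by rewrite ler_nat. Qed.
Lemma eps_b : b%:R * (5 * eps) <= 1.
Proof.
have : b%:R * 1 <= b%:R * b%:R :> R by rewrite ler_wpM2l//; have := b1; lra.
move=> bb; have : b%:R * 1 * eps <= b%:R * b%:R * eps by rewrite ler_wpM2r// ltW.
have : 0 <= b%:R * b%:R * eps by rewrite !mulr_ge0// ltW.
by move: eps_small; rewrite expr2; lra.
Qed.
Lemma eps5 : 5 * eps <= 1.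
Proof.
have : 1 * (5 * eps) <= b%:R * (5 * eps).
  by apply: ler_wpM2r; [rewrite mulr_ge0// ltW|rewrite ler1n].
by have := eps_b; lra.
Qed.

Lemma L_le : L <= 4 * eps.
Proof.
have sp t : `|t| <= eps -> `|speed m t| <= 2.
  move=> te; have t1 : `|t| <= 1 by have := eps5; have := eps_gt0; lra.
  rewrite gtr0_norm ?speed_gt0//.
  have s1 : slope m t <= 1.
    apply: (le_trans (slope_le m t1)); apply: (@le_trans _ _ (b%:R * (5 * eps))); last exact: eps_b.
    have := normr_ge0 t; have : b%:R * `|t| <= b%:R * eps by rewrite ler_wpM2l.
    have : 0 <= b%:R * eps by rewrite mulr_ge0// ltW.
    by lra.
  rewrite -[leRHS]ger0_norm// -sqrtr_sqr ler_sqrt ?sqr_ge0//.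
  by have := slope_ge0 m t; nra.
have := is_derive_bound dLam sp (u := - eps) (v := eps).
rewrite normrN gtr0_norm// lexx opprK => /(_ isT isT) H.
apply: (le_trans (ler_norm _)); apply: (le_trans H).
by have e0 := eps_gt0; rewrite ger0_norm; lra.
Qed.

Variable H : R -> R.
Hypothesis dH : ac_derive a c H w.
Hypothesis short : H c - H a < L.

Lemma H_mono u v : a <= u -> u <= v -> v <= c -> H u <= H v.
Proof.
move=> au uv vc; have := ac_derive_le uv (ac_derive_cst u v 0) (ac_deriveS au vc dH).
by rewrite subr0 subr_ge0; apply => t _; exact: sqrtr_ge0.
Qed.

(** A competitor shorter than the curve has length at most [4 eps], so it stays that close to its
    starting point; the initial height [- eps] adds one more [eps] to [y]. *)
Lemma box t : a <= t -> t <= c -> `|x t| <= 4 * eps /\ `|y t| <= 5 * eps.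
Proof.
move=> at_ tc; have Ht : H t - H a <= 4 * eps.
  by have := H_mono at_ tc (lexx c); have := L_le; move: short; lra.
have dxt := ac_deriveS (lexx a) tc dx; have dyt := ac_deriveS (lexx a) tc dy.
have dHt := ac_deriveS (lexx a) tc dH.
have Hx : `|x t - x a| <= H t - H a.
  by apply: (ac_derive_norm_le dxt dHt at_) => s _; exact: (norm_le_speed _ _).1.
have Hy : `|y t - y a| <= H t - H a.
  by apply: (ac_derive_norm_le dyt dHt at_) => s _; exact: (norm_le_speed _ _).2.
move: Hx Hy; rewrite xa ya subr0 opprK => Hx /ler_normlP[Hy1 Hy2].
by split; [lra|rewrite ler_norml; lra].
Qed.

Lemma sine_small t : a <= t -> t <= c -> sine m (y t) <= 2^-1.
Proof.
move=> at_ tc; have [_ yt] := box at_ tc.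
have y1 : `|y t| <= 1 by have := eps5; have := eps_gt0; lra.
apply: (le_trans (sine_le_slope _ _)); apply: (le_trans (slope_le m y1)).
have : b%:R * `|y t| <= b%:R * (5 * eps) by rewrite ler_wpM2l.
by have := eps_b; lra.
Qed.

Lemma gain_small t : a <= t -> t <= c -> `|gain t| <= 10 * b%:R ^+ 2 * eps.
Proof.
move=> at_ tc; have [xt yt] := box at_ tc.
have y1 : `|y t| <= 1 by have := eps5; have := eps_gt0; lra.
rewrite /gain normrM [X in _ * X]ger0_norm ?sine'_ge0//.
have h9 : `|x t - profile m (y t)| <= 10 * eps.
  apply: (le_trans (ler_normB _ _)); rewrite [X in _ + X]ger0_norm ?profile_ge0//.
  by have := profile_le_norm m y1; have := eps_gt0; lra.
have k1 : sine' m (y t) <= b%:R ^+ 2.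
  apply: (le_trans (sine'_le _ _)); rewrite ler_piMr ?sqr_ge0//.
  by rewrite exprn_ile1 ?sqrtr_ge0// sqrt_le1.
apply: (le_trans (ler_pM _ _ h9 k1)) => //; first exact: sine'_ge0.
by rewrite le_eqVlt; apply/orP; left; apply/eqP; ring.
Qed.

Lemma gauge_ac : abs_cont a c (fun t => gauge m (x t) (y t)).
Proof.
apply: (@abs_cont_dom _ _ _ _ x y (4 * b%:R)); last 2 first.
- exact: (proj1 dx).
- exact: (proj1 dy).
move=> u v au uv vc.
have [xu yu] := box au (le_trans uv vc); have [xv yv] := box (le_trans au uv) vc.
have B1 (t : R) : `|t| <= 4 * eps -> `|t| <= 1 by have := eps5; have := eps_gt0; lra.
have B2 (t : R) : `|t| <= 5 * eps -> `|t| <= 1 by have := eps5; have := eps_gt0; lra.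
rewrite ler_norml; apply/andP; split.
  have := gauge_lipschitz m (B1 _ xu) (B1 _ xv) (B2 _ yu) (B2 _ yv).
  by rewrite (distrC (x u)) (distrC (y u)); lra.
have := gauge_lipschitz m (B1 _ xv) (B1 _ xu) (B2 _ yv) (B2 _ yu).
by lra.
Qed.

Variable J : R -> R.
Hypothesis dJ : ac_derive a c J (fun t => gain t * Y t).
(** The running excess: arc length minus calibration, with the gain contained in [S] added back.
    Over [[a, c]] it grows by the length minus [L] plus the increment of [J]. *)
Let E t := H t - S t + J t.

Lemma dE : ac_derive a c E (fun t => excess m (y t) (X t) (Y t)).
Proof.
apply: ac_derive_eq (ac_deriveD (ac_deriveB dH dS) dJ) => t _.
by rewrite /excess -speed_sine /gain /w; ring.
Qed.

Lemma E_mono u v : a <= u -> u <= v -> v <= c -> E u <= E v.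
Proof.
move=> au uv vc; have := ac_derive_le uv (ac_derive_cst u v 0) (ac_deriveS au vc dE).
by rewrite subr0 subr_ge0; apply => t _; exact: excess_ge0.
Qed.

Lemma zeta_ac : zeta c = zeta a.
Proof.
rewrite /zeta zc yc za ya subrr sub0r /height ler0_sqrtr ?oppr_le0 ?ltW//.
by rewrite expr0n addn_eq0 andbF mul0r !oppr0.
Qed.

(** This is max Q <~ E ^ 2, with the gauge for sqrt Q. Rising from half of its maximum to the
    maximum costs the Lipschitz gauge a displacement of order [g / b], and the excess bounds that
    displacement. *)
Lemma gauge_bound : exists g, [/\ 0 <= g, g <= 2 ^+ 12 * b%:R * (E c - E a) &
  forall t, a <= t -> t <= c -> gauge m (x t) (y t) <= g].
Proof.
have [ts tsac Hts] := EVT_max ac (abs_cont_within ac gauge_ac).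
move: tsac; rewrite in_itv/= => /andP[ats tsc].
set g := gauge m (x ts) (y ts) in Hts.
have g0 : 0 <= g by rewrite mulr_ge0// !addr_ge0 ?profile_ge0.
have E0 : 0 <= E c - E a by rewrite subr_ge0; exact: E_mono.
exists g; split=> // [|t at_ tc]; last by apply: Hts; rewrite in_itv/= at_ tc.
have [g_le0|g_gt0] := leP g 0.
  by apply: (le_trans g_le0); rewrite !mulr_ge0// exprn_ge0.
have Ga : gauge m (x a) (y a) <= g / 2.
  have -> : gauge m (x a) (y a) = 0; last by lra.
  by rewrite /gauge xa ya normr0 profile_le0 ?oppr_le0 ?ltW// subrr normr0 mul0r.
have [t0 [at0 t0ts Gt0 Gt]] := last_crossing ats (abs_contS (lexx a) tsc gauge_ac) Ga.
have t0c : t0 <= c by exact: le_trans tsc.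
pose V t := 2 * E t + 24 / g ^+ 2 * (zeta t + 8 * g ^+ 2 * E t).
have dD : ac_derive a c (fun t => zeta t + 8 * g ^+ 2 * E t)
  (fun t => defect m (x t) (y t) * Y t + 8 * g ^+ 2 * excess m (y t) (X t) (Y t)).
  by apply: ac_deriveD; [exact: dzeta|exact: (ac_deriveZ _ dE)].
have dV : ac_derive a c V (fun t => 2 * excess m (y t) (X t) (Y t) + 24 / g ^+ 2 *
   (defect m (x t) (y t) * Y t + 8 * g ^+ 2 * excess m (y t) (X t) (Y t))).
  by apply: ac_deriveD; [exact: (ac_deriveZ _ dE)|exact: (ac_deriveZ _ dD)].
(* Backward motion lowers [zeta] by at most [4 g ^ 2] times the excess, so adding [8 g ^ 2 E] makes
   it monotone. The increment on [[t0, ts]] is then at most that on [[a, c]], where [zeta]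
   cancels. *)
have D_mono u v : a <= u -> u <= v -> v <= c ->
    zeta u + 8 * g ^+ 2 * E u <= zeta v + 8 * g ^+ 2 * E v.
  move=> au uv vc; have := ac_derive_le uv (ac_derive_cst u v 0) (ac_deriveS au vc dD).
  rewrite subr0 subr_ge0; apply => t /andP[ut tv].
  have at_ : a <= t by lra.
  have tc : t <= c by lra.
  have e0 := excess_ge0 m (y t) (X t) (Y t).
  have [_ _ neg] := excess_bounds (X t) (Y t) (sine_small at_ tc).
  have d0 := defect_ge0 modd (x t) (y t).
  have gg0 : 0 <= g ^+ 2 by exact: sqr_ge0.
  have ge0 : 0 <= g ^+ 2 * excess m (y t) (X t) (Y t) by exact: mulr_ge0.
  have [Y0|Y0] := ltP (Y t) 0; last first.
    by clear neg; have := mulr_ge0 d0 Y0; lra.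
  have := neg Y0; clear neg; rewrite (ltr0_norm Y0) => Ye.
  have d2 : defect m (x t) (y t) <= 2 * g ^+ 2.
    have [_ G2] := gauge_defect modd (x t) (y t); apply: (le_trans G2).
    have Gg : gauge m (x t) (y t) <= g by apply: Hts; rewrite in_itv/= at_ tc.
    by rewrite ler_wpM2l// ler_sqr ?nnegrE// mulr_ge0// !addr_ge0 ?profile_ge0.
  have : defect m (x t) (y t) * (- Y t) <= 2 * g ^+ 2 * (2 * excess m (y t) (X t) (Y t)).
    by apply: ler_pM => //; lra.
  by lra.
(* The constant is [2 + 24 * 8]. *)
have Vle : V ts - V t0 <= 194 * (E c - E a).
  have -> : V ts - V t0 = 2 * (E ts - E t0) + 24 / g ^+ 2 *
    ((zeta ts + 8 * g ^+ 2 * E ts) - (zeta t0 + 8 * g ^+ 2 * E t0)) by rewrite /V; ring.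
  have e1 := E_mono (lexx a) at0 t0c; have e2 := E_mono ats tsc (lexx c).
  have z1 := D_mono _ _ (lexx a) at0 t0c; have z2 := D_mono _ _ ats tsc (lexx c).
  have : 24 / g ^+ 2 * ((zeta ts + 8 * g ^+ 2 * E ts) - (zeta t0 + 8 * g ^+ 2 * E t0)) <=
     24 / g ^+ 2 * (8 * g ^+ 2 * (E c - E a)).
    apply: ler_wpM2l; first by rewrite divr_ge0// sqr_ge0.
    by rewrite zeta_ac in z2; lra.
  have -> : 24 / g ^+ 2 * (8 * g ^+ 2 * (E c - E a)) = 192 * (E c - E a).
    by field; rewrite gt_eqF.
  by lra.
have pt t : t0 < t < ts -> `|X t| + `|Y t| <= 2 * excess m (y t) (X t) (Y t) +
    24 / g ^+ 2 * (defect m (x t) (y t) * Y t + 8 * g ^+ 2 * excess m (y t) (X t) (Y t)).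
  move=> /andP[t0t tts].
  have at_ : a <= t by lra.
  have tc : t <= c by lra.
  apply: variation_le_defect => //; first exact: sine_small.
    by apply/ltW/Gt => //; exact: ltW.
  by apply: Hts; rewrite in_itv/= at_ tc.
have Vx : `|x ts - x t0| <= V ts - V t0.
  apply: (ac_derive_norm_le (ac_deriveS at0 tsc dx) (ac_deriveS at0 tsc dV) t0ts) => t /pt.
  by apply: le_trans; rewrite lerDl.
have Vy : `|y ts - y t0| <= V ts - V t0.
  apply: (ac_derive_norm_le (ac_deriveS at0 tsc dy) (ac_deriveS at0 tsc dV) t0ts) => t /pt.
  by apply: le_trans; rewrite lerDr.
have [xs ys] := box ats tsc; have [x0 y0] := box at0 t0c.
have := gauge_lipschitz m (x := x ts) (x' := x t0) (y := y ts) (y' := y t0).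
rewrite -/g => /(_ _ _ _ _) Lip.
have {}Lip : g <= gauge m (x t0) (y t0) + 4 * b%:R * (`|x ts - x t0| + `|y ts - y t0|).
  have e4 : 4 * eps <= 1 by have := eps5; have := eps_gt0; lra.
  by apply: Lip; [exact: le_trans xs e4|exact: le_trans x0 e4|
    exact: le_trans ys eps5|exact: le_trans y0 eps5].
(* With both displacements at most 194 times the excess, [g / 2 <= 4 * 388 * b * (E c - E a)], and
   [3104 < 2 ^ 12]. *)
have : b%:R * (`|x ts - x t0| + `|y ts - y t0|) <= b%:R * (388 * (E c - E a)).
  by rewrite ler_wpM2l//; lra.
have bE : 0 <= b%:R * (E c - E a) by rewrite mulr_ge0.
by move=> ?; lra.
Qed.

Lemma S_diff : S c - S a = L.
Proof.
rewrite /S xc yc xa ya (@profile_le0 _ m (- eps)) ?oppr_le0 ?ltW//.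
by rewrite !subrr !mul0r !addr0.
Qed.

(** A crude bound from [gain_small] alone: it serves only to make the excess, and with it the later
    scale [rho], small. *)
Lemma excess_le : E c - E a <= (H c - H a) - L + 10 * b%:R ^+ 2 * eps * (H c - H a).
Proof.
have JH : `|J c - J a| <= 10 * b%:R ^+ 2 * eps * H c - 10 * b%:R ^+ 2 * eps * H a.
  apply: (ac_derive_norm_le dJ (ac_deriveZ _ dH) ac) => t /andP[at_ tc].
  rewrite normrM; apply: ler_pM => //; first by apply: gain_small; exact: ltW.
  exact: (norm_le_speed _ _).2.
by have := ler_norm (J c - J a); rewrite -S_diff /E; lra.
Qed.

(** Integrates [gain_velocity]: the defect term contributes nothing because [zeta] has equal end
    values, and [barrier_le] bounds the second term. *)
Lemma excess_barrier rho g : 0 < rho ->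
  (forall t, a <= t -> t <= c -> gauge m (x t) (y t) <= g) ->
  E c - E a <= (H c - H a) - L + b%:R ^+ 2 * (8 * rho ^+ (2 * m + 8)) +
    2 * (10 * b%:R ^+ 2 * eps + b%:R ^+ 2 / rho ^+ (2 * m + 14) * (2 * g ^+ 2) +
         b%:R ^+ 2 * (2 * rho ^+ (2 * m + 6))) * (E c - E a).
Proof.
move=> rho_gt0 gg; set eta := 2 * (_ + _ + _).
have dG := ac_deriveD (ac_deriveD (ac_deriveD (ac_deriveB dH dS)
  (ac_deriveZ (b%:R ^+ 2 / rho ^+ (2 * m + 14)) dzeta))
  (ac_deriveZ (b%:R ^+ 2) (dbarrier rho_gt0))) (ac_deriveZ eta dE).
have := ac_derive_le ac dE dG.
rewrite zeta_ac => /(_ _) GE.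
have {}GE : E c - E a <= H c - S c - (H a - S a) + b%:R ^+ 2 * (barrier rho c - barrier rho a) +
    eta * (E c - E a).
  apply: le_trans (GE _) _; last first.
    by rewrite le_eqVlt; apply/orP; left; apply/eqP; ring.
  move=> t /andP[/ltW at_ /ltW tc].
  have d2 : defect m (x t) (y t) <= 2 * g ^+ 2.
    have [_ G2] := gauge_defect modd (x t) (y t); apply: (le_trans G2).
    have g0 : 0 <= gauge m (x t) (y t) by rewrite mulr_ge0// !addr_ge0 ?profile_ge0.
    rewrite ler_wpM2l// ler_sqr ?nnegrE//; first exact: gg.
    by apply: (le_trans g0); exact: gg.
  have := gain_velocity modd (X t) (Y t) rho_gt0 (sine_small at_ tc) (gain_small at_ tc) d2.
  by rewrite /excess -speed_sine -/eta /w; lra.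
apply: (le_trans GE); rewrite lerD2r.
have := ler_wpM2l (sqr_ge0 (b%:R : R)) (barrier_le rho_gt0).
by have := S_diff; lra.
Qed.

Hypothesis rho0_gt0 : 0 < rho0.
Hypothesis rho0_le1 : rho0 <= 1.
Hypothesis rho0_small : 2 * (2 ^+ 12) ^+ 3 * b%:R ^+ 8 * rho0 <= 1.
Hypothesis eps_rho0 : eps <= rho0 ^+ (2 * m + 8).

Lemma root_exists (n : nat) (v : R) : 0 < v -> exists2 r, 0 < r & r ^+ n.+1 = v.
Proof.
move=> v0; exists (v `^ n.+1%:R^-1); first exact: powR_gt0.
by rewrite -powR_mulrn ?powR_ge0// -powRrM mulVf// powRr1// ltW.
Qed.

(* The scale [rho] is chosen so that [8 b ^ 2 rho ^ (2 b - 2)], the cost of the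
   barrier, is half of the excess plus the length deficit; since [b >= 5] the
   remaining coefficient of the excess is then at most [1 / 2]. *)
Lemma no_short_curve : False.
Proof.
have e0 : 0 <= E c - E a by rewrite subr_ge0; exact: E_mono.
have [g [g0 gE gg]] := gauge_bound.
have eH := excess_le.
have Ha : H a <= H c by apply: H_mono.
set e := E c - E a in e0 gE eH *; set d := L - (H c - H a).
have d0 : 0 < d by rewrite subr_gt0; exact: short.
set k := (b%:R : R) ^+ 2.
have k1 : 1 <= k by rewrite exprn_ege1// ler1n.
have k0 : 0 < k by lra.
have v0 : 0 < (e + d) / (16 * k) by rewrite divr_gt0//; lra.
have [rho rho_gt0] := root_exists (2 * m + 7) v0.
have -> : (2 * m + 7).+1 = (2 * m + 8)%N by exact/esym/addnS.
move=> rhoE.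
have {}rhoE : e + d = 16 * k * rho ^+ (2 * m + 8).
  by rewrite rhoE mulrC divfK// gt_eqF//; lra.
have eps0 := eps_gt0; have e5 := eps5; have Le := L_le.
have H4 : k * eps * (H c - H a) <= k * eps * (4 * eps).
  by apply: ler_wpM2l; [rewrite mulr_ge0 ?ltW|rewrite /d in d0; lra].
have H5 : k * eps * (5 * eps) <= k * eps * 1.
  by apply: ler_wpM2l => //; rewrite mulr_ge0 ?ltW.
(* By [excess_le], [16 k rho ^ (2 m + 8) = e + d <= 40 k eps ^ 2 <= 8 k eps]. *)
have rho_eps : rho ^+ (2 * m + 8) < eps.
  rewrite -(ltr_pM2l k0); have : 0 < k * eps by exact: mulr_gt0.
  by move: rhoE eH; rewrite -/k /d; lra.
have rho_rho0 : rho <= rho0.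
  rewrite leNgt; apply/negP => rr.
  have : rho0 ^+ (2 * m + 8) <= rho ^+ (2 * m + 8).
    by apply: lerXn2r; rewrite ?nnegrE ltW.
  by have := eps_rho0; lra.
have powle (n : nat) : rho ^+ n.+1 <= rho0.
  apply: (le_trans _ rho_rho0); rewrite exprS; apply: ler_piMr; first exact: ltW.
  by apply: exprn_ile1; [exact: ltW|exact: le_trans rho_rho0 rho0_le1].
have small : 2 * (2 ^+ 12) ^+ 3 * k ^+ 4 * rho0 <= 1.
  have -> : k ^+ 4 = b%:R ^+ 8 by rewrite /k -exprM.
  exact: rho0_small.
have A8 : (2 : R) ^+ 12 = 8 * 2 ^+ 9 by rewrite (exprD _ 3 9); ring.
have B16 : (2 : R) ^+ 9 = 2 * 16 * 16 by ring.
move: gE small A8 B16; set A := (2 : R) ^+ 12; set B := (2 : R) ^+ 9 => gE small A8 B16.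
have k4 : k <= k ^+ 4 by rewrite -[leLHS]expr1 ler_weXn2l.
have T2 : k * (2 * rho ^+ (2 * m + 6)) <= 12^-1.
  have -> : (2 * m + 6 = (2 * m + 5).+1)%N by exact: addnS.
  have := powle (2 * m + 5)%N; set r := _ ^+ _ => rr0.
  have r0 : 0 <= rho0 by exact: ltW.
  have H6 : k * r <= k * rho0 by apply: ler_wpM2l => //; exact: ltW.
  have H7 : k * rho0 <= k ^+ 4 * rho0 by rewrite ler_wpM2r.
  have A3 : 12 <= A ^+ 3.
    have : 1 <= A ^+ 2 by rewrite exprn_ege1//; lra.
    by rewrite (exprS A 2); move=> ?; rewrite A8 B16; lra.
  have H8 : 12 * (k ^+ 4 * rho0) <= A ^+ 3 * (k ^+ 4 * rho0).
    by rewrite ler_wpM2r// mulr_ge0// exprn_ge0// ltW.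
  by lra.
have T1 : k / rho ^+ (2 * m + 14) * (2 * g ^+ 2) <= 12^-1.
  have g2 : g ^+ 2 <= (A * b%:R * (e + d)) ^+ 2.
    have gEd : g <= A * b%:R * (e + d).
      by apply: (le_trans gE); rewrite ler_wpM2l ?mulr_ge0 ?exprn_ge0// lerDl ltW.
    by rewrite ler_sqr ?nnegrE// (le_trans g0).
  apply: (@le_trans _ _ (k / rho ^+ (2 * m + 14) * (2 * (A * b%:R * (e + d)) ^+ 2))).
    by rewrite ler_wpM2l ?ler_wpM2l// divr_ge0 ?exprn_ge0 ?ltW.
  (* The remaining power of [rho] is [2 (2 m + 8) - (2 m + 14) = 2 m + 2 = 2 b - 8], positive
     because [b >= 5]. *)
  have -> : k / rho ^+ (2 * m + 14) * (2 * (A * b%:R * (e + d)) ^+ 2) =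
     B * A ^+ 2 * k ^+ 4 * rho ^+ (2 * m + 2).
    rewrite rhoE B16.
    have -> : (A * b%:R * (16 * k * rho ^+ (2 * m + 8))) ^+ 2 =
       256 * A ^+ 2 * k ^+ 3 * (rho ^+ (2 * m + 8)) ^+ 2 by rewrite /k; ring.
    have -> : (rho ^+ (2 * m + 8)) ^+ 2 = rho ^+ (2 * m + 2) * rho ^+ (2 * m + 14).
      by rewrite -exprM -exprD; congr (_ ^+ _); ring.
    have rn : rho ^+ (2 * m + 14) != 0 by rewrite expf_neq0// gt_eqF.
    by field.
  have -> : (2 * m + 2 = (2 * m + 1).+1)%N by exact: addnS.
  have := powle (2 * m + 1)%N; set r := _ ^+ _ => rr0.
  have C0 : 0 <= B * A ^+ 2 * k ^+ 4.
    by rewrite !mulr_ge0 ?exprn_ge0 ?sqr_ge0// ltW.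
  have H6 : B * A ^+ 2 * k ^+ 4 * r <= B * A ^+ 2 * k ^+ 4 * rho0 by exact: ler_wpM2l.
  have r0 : 0 <= B * A ^+ 2 * k ^+ 4 * rho0 by rewrite mulr_ge0// ltW.
  have : 2 * A ^+ 3 * k ^+ 4 * rho0 = 16 * (B * A ^+ 2 * k ^+ 4 * rho0).
    by rewrite (exprS A 2) {1}A8; ring.
  by lra.
have T0 : 10 * k * eps <= 12^-1 by have := eps_small; rewrite -/k; lra.
(* The barrier costs [(e + d) / 2] and the three coefficients add up to at most [1 / 4], doubled in
   the estimate. Hence [e <= - d + (e + d) / 2 + e / 2], against [0 < d]. *)
have := excess_barrier rho_gt0 gg; rewrite -/e -/k.
set eta := 10 * k * eps + _ + _ => main.
have eta4 : eta * e <= 4^-1 * e by rewrite ler_wpM2r// /eta; lra.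
by move: main rhoE d0; rewrite /d; lra.
Qed.
End LowerBound.

(** * The curves gamma and gammabar *)

Section Curves.
Variables (R : realType) (m : nat).
Hypothesis modd : ~~ odd m.
Local Notation b := (m.+4.+1).
Notation mu := (@lebesgue_measure R).

(** The constants are fixed in the order [b], [rho0], [eps]; a shorter competitor, equipped with
    primitives of its speed and of its gain, contradicts [no_short_curve]. *)
Lemma curve_lower_bound : exists2 eps : R, 0 < eps & forall (Lam : R -> R),
  (forall y, is_derive y (1 : R) Lam (speed m y)) ->
  forall (a c : R) (x y z X Y : R -> R), a <= c ->
  ac_derive a c x X -> ac_derive a c y Y ->
  ac_derive a c z (fun t => (x t ^+ 2 - y t ^+ b) ^+ 2 * Y t) ->
  measurable_fun setT X -> measurable_fun setT Y ->
  mu.-integrable `[a, c] (EFin \o (fun t => Num.sqrt (X t ^+ 2 + Y t ^+ 2))) ->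
  [/\ x a = 0, y a = - eps & z a = height m (- eps)] ->
  [/\ x c = profile m eps, y c = eps & z c = 0] ->
  Lam eps - Lam (- eps) <= \int[mu]_(t in `[a, c]) Num.sqrt (X t ^+ 2 + Y t ^+ 2).
Proof.
have b1 : 1 <= b%:R :> R by rewrite ler1n.
pose D : R := 2 * (2 ^+ 12) ^+ 3 * b%:R ^+ 8.
have D1 : 1 <= D.
  have A1 : 1 <= (2 ^+ 12) ^+ 3 :> R by rewrite !exprn_ege1// ler1n.
  have B1 : 1 <= b%:R ^+ 8 :> R by rewrite exprn_ege1.
  rewrite /D; set A := (2 ^+ 12) ^+ 3 in A1 *; set B := _ ^+ 8 in B1 *.
  by nra.
have D0 : 0 < D by lra.
pose rho0 := D^-1.
have r0 : 0 < rho0 by rewrite invr_gt0.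
have r1 : rho0 <= 1 by rewrite invf_le1.
have rs : 2 * (2 ^+ 12) ^+ 3 * b%:R ^+ 8 * rho0 <= 1 by rewrite -/D /rho0 mulfV// gt_eqF.
have k1 : 1 <= b%:R ^+ 2 :> R by rewrite exprn_ege1.
have k0 : 0 < 120 * b%:R ^+ 2 :> R by lra.
have p0 : 0 < rho0 ^+ (2 * m + 8) by rewrite exprn_gt0.
pose eps := rho0 ^+ (2 * m + 8) / (120 * b%:R ^+ 2).
have e0 : 0 < eps by rewrite divr_gt0.
have es : 120 * b%:R ^+ 2 * eps <= 1.
  by rewrite /eps mulrC divfK ?gt_eqF// exprn_ile1// ltW.
have er : eps <= rho0 ^+ (2 * m + 8).
  by rewrite /eps ler_pdivrMr// ler_peMr ?ltW//; lra.
exists eps => // Lam dLam a c x y z X Y ac dx dy dz mX mY iw [xa ya za] [xc yc zc].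
rewrite leNgt; apply/negP => short.
have mw : measurable_fun setT (fun t => Num.sqrt (X t ^+ 2 + Y t ^+ 2)).
  apply: measurableT_comp; first by apply: continuous_measurable_fun; exact: sqrt_continuous.
  by apply: measurable_funD; apply: measurable_funX.
have [H [AH dH HE]] := integrable_primitive ac mw iw.
have [J dJ] := gain_primitive m ac dx dy mY iw.
rewrite -HE in short.
exact: (no_short_curve modd dLam ac dx dy dz iw e0 es xa ya za xc yc zc (conj AH dH) short dJ
  r0 r1 rs er).
Qed.

(** One formula for both curves: [sg] is the sign of the first coordinate, and [a0] shifts time
    because competitors in [d_SR] start at time 0. *)
Definition curve (sg a0 t : R) : pt R :=
  (sg * profile m (t + a0), t + a0, height m (t + a0)).

Let dshift a0 (F f : R -> R) t : (forall y, is_derive y (1 : R) F (f y)) ->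
  is_derive t (1 : R) (fun t => F (t + a0)) (f (t + a0)).
Proof.
move=> dF; have dF' := dF (t + a0).
have ds : is_derive t (1 : R) (fun t => t + a0) 1.
  by apply: is_derive_eq; rewrite addr0.
by have := @is_derive1_comp R F (fun t => t + a0) t _ _ dF' ds; rewrite mulr1.
Qed.

Let cshift a0 (f : R -> R) : continuous f -> continuous (fun t => f (t + a0)).
Proof.
move=> cf t; apply: (@continuous_comp _ _ _ (fun t => t + a0) f); last exact: cf.
by apply: cvgD; [exact: cvg_id|exact: cvg_cst].
Qed.

Let is_derive_curve sg a0 t :
  [/\ is_derive t (1 : R) (@x1 R \o curve sg a0) (sg * slope m (t + a0)),
      is_derive t (1 : R) (@x2 R \o curve sg a0) 1 &
      is_derive t (1 : R) (@x3 R \o curve sg a0) (Num.sqrt (- (t + a0)) ^+ (4 * m + 20))].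
Proof.
split.
- have d := dshift a0 t (@is_derive_profile R m).
  exact: (is_deriveZ sg d).
- by have := dshift a0 t (fun y => is_derive_id y (1 : R)).
- exact: (dshift a0 t (@is_derive_height R m)).
Qed.

Lemma horizontal_curve sg a0 a c : sg ^+ 2 = 1 -> a <= c ->
  horizontal b a c (curve sg a0).
Proof.
move=> sg1 ac; split=> //; split.
  apply: abs_contZ; apply: (proj1 (ac_derive_C1 (f := fun t => slope m (t + a0)) _ _ ac)) => //.
    by move=> t; apply: dshift; exact: is_derive_profile.
  by apply: cshift; exact: continuous_slope.
split.
  apply: (proj1 (ac_derive_C1 (f := fun=> 1) _ _ ac)) => [t|t]; last exact: cvg_cst.
  by have [] := is_derive_curve sg a0 t.
split.
  apply: (proj1 (ac_derive_C1 (f := fun t => Num.sqrt (- (t + a0)) ^+ (4 * m + 20)) _ _ ac)) => //.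
    by move=> t; have [] := is_derive_curve sg a0 t.
  move=> t; apply: (@continuous_comp _ _ _ (fun t : R => - (t + a0))
    (fun t => Num.sqrt t ^+ (4 * m + 20))).
    by apply: cvgN; apply: cvgD; [exact: cvg_id|exact: cvg_cst].
  exact: continuous_sqrtX.
apply: (@filterE _ _ (ae_filter_ringOfSetsType mu)) => t _.
have [[d1 _] [d2 E2] [d3 E3]] := is_derive_curve sg a0 t.
split=> //; rewrite !derive1E E2 E3 mulr1 (sqrtN_power modd (t + a0)).
have -> : Ppoly b (curve sg a0 t) = profile m (- (t + a0)) ^+ 2; last by rewrite -exprM.
rewrite /Ppoly (_ : x1 _ = sg * profile m (t + a0))// (_ : x2 _ = t + a0)//.
by rewrite odd_power// exprMn sg1 mul1r opprB addrC subrK.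
Qed.

Lemma sr_length_curve sg a0 a c (Lam : R -> R) :
  (forall y, is_derive y (1 : R) Lam (speed m y)) -> sg ^+ 2 = 1 -> a < c ->
  sr_length a c (curve sg a0) = (Lam (c + a0) - Lam (a + a0))%:E.
Proof.
move=> dLam sg1 ac; rewrite /sr_length.
transitivity (\int[mu]_(t in `[a, c]) (speed m (t + a0))%:E)%E.
  apply: eq_integral => t _; have [[_ E1] [_ E2] _] := is_derive_curve sg a0 t.
  by rewrite !derive1E E1 E2 exprMn sg1 mul1r expr1n addrC.
have dL t := dshift a0 t dLam.
have cL : continuous (fun t => Lam (t + a0)) by exact: is_derive_continuous dL.
rewrite (@continuous_FTC2 R (fun t => speed m (t + a0)) (fun t => Lam (t + a0)) a c ac).
- by rewrite EFinB.
- by apply: continuous_subspaceT; apply: cshift; exact: continuous_speed.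
- split.
  + by move=> t _; case: (dL t).
  + by apply: cvg_at_right_filter; exact: cL.
  + by apply: cvg_at_left_filter; exact: cL.
- by move=> t _; rewrite derive1E; case: (dL t).
Qed.

Lemma curve_minimizing : exists2 eps : R, 0 < eps & forall sg, sg ^+ 2 = 1 ->
  sr_length (- eps) eps (curve sg 0) = d_SR b (curve sg 0 (- eps)) (curve sg 0 eps).
Proof.
have [eps e0 Heps] := curve_lower_bound.
have [Lam dLam] := speed_primitive R m.
exists eps => // sg sg1.
have ee : - eps < eps by lra.
rewrite (sr_length_curve 0 dLam sg1 ee) !addr0.
apply/eqP; rewrite eq_le; apply/andP; split; last first.
  apply: ereal_inf_lbound; exists (eps + eps), (curve sg (- eps)).
  have e2 : 0 < eps + eps by lra.
  split.
  - by apply: horizontal_curve => //; exact: ltW.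
  - by rewrite /curve add0r addr0.
  - by rewrite /curve addrK addr0.
  - by rewrite (sr_length_curve _ dLam sg1 e2) addrK add0r.
apply: le_ereal_inf_tmp => _ [T [eta [hor eta0 etaT ->]]].
have [->|Loo] := eqVneq (sr_length 0 T eta) +oo%E; first exact: leey.
have [|X [Y [mX mY dXYZ iw intw]]] := horizontal_speed hor; first by rewrite ltey.
have [T0 [Ax [Ay [Az _]]]] := hor.
apply: le_trans intw; rewrite lee_fin.
have wE t : Num.sqrt (X t ^+ 2 + Y t ^+ 2) = Num.sqrt ((sg * X t) ^+ 2 + Y t ^+ 2).
  by rewrite exprMn sg1 mul1r.
have aeS (P Q : R -> Prop) : (forall t, P t -> Q t) ->
    {ae mu, forall t, P t} -> {ae mu, forall t, Q t}.
  by move=> PQ; exact: (@filterS _ _ (ae_filter_ringOfSetsType mu)).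
(* The reflection [x1 -> - x1] preserves [P] and the length, so multiplying by [sg] reduces both
   signs to the same lower bound. *)
have dx : ac_derive 0 T (fun t => sg * x1 (eta t)) (fun t => sg * X t).
  apply: ac_deriveZ; split=> //; apply: aeS dXYZ => t Ht tT.
  by have [] := Ht tT.
have dy : ac_derive 0 T (fun t => x2 (eta t)) Y.
  by split=> //; apply: aeS dXYZ => t Ht tT; have [] := Ht tT.
have dz : ac_derive 0 T (fun t => x3 (eta t))
    (fun t => ((sg * x1 (eta t)) ^+ 2 - x2 (eta t) ^+ b) ^+ 2 * Y t).
  split=> //; apply: aeS dXYZ => t Ht tT; rewrite exprMn sg1 mul1r.
  by have [] := Ht tT.
under eq_Rintegral do rewrite wE.
apply: (Heps Lam dLam 0 T _ _ _ _ _ T0 dx dy dz) => //.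
- by apply: measurable_funM.
- by apply: eq_integrable iw => // t _ /=; rewrite wE.
- rewrite eta0 /curve /x1 /x2 /x3 /= addr0 profile_le0 ?oppr_le0 ?ltW//.
  by rewrite !mulr0.
- rewrite etaT /curve /x1 /x2 /x3 /= addr0 mulrA -expr2 sg1 mul1r; split=> //.
  by rewrite /height ler0_sqrtr ?oppr_le0 ?ltW// expr0n addn_eq0 andbF mul0r oppr0.
Qed.

Lemma gamma_curve : @gamma R b = curve 1 0.
Proof.
apply/funext => t; rewrite /gamma /curve addr0 mul1r; case: ltP => t0.
  rewrite profile_le0 ?ltW//; congr (_, _, _); rewrite /height.
  have -> : (2 * b + 1 = 2 * m + 11)%N by lia.
  have -> : (4 * m + 22 = 2 * (2 * m + 11))%N by lia.
  rewrite exprM sqr_sqrtr ?oppr_ge0 ?ltW// exprNn -signr_odd oddD oddM /=.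
  by rewrite expr1 mulN1r mulNr opprK.
rewrite powR_half// /height (@ler0_sqrtr _ (- t)) ?oppr_le0// expr0n addn_eq0 andbF mul0r oppr0.
by [].
Qed.

Lemma gammabar_curve : @gammabar R b = curve (-1) 0.
Proof.
have := gamma_curve => /funeqP gE; apply/funext => t; have := gE t.
rewrite /gamma /gammabar /curve addr0 mul1r mulN1r; case: ltP => t0 [<- <-] //.
by rewrite oppr0.
Qed.
End Curves.

Theorem theorem1p1 (R : realType) (b : nat) (hodd : odd b) (hb : (5 <= b)%N) :
  exists (eps s : R), [/\ 0 < eps, 0 < s,
    horizontal b (- s) eps (gamma b) /\
      sr_length (- s) eps (gamma b) = d_SR b (gamma b (- s)) (gamma b eps) &
    horizontal b (- s) eps (gammabar b) /\
      sr_length (- s) eps (gammabar b) = d_SR b (gammabar b (- s)) (gammabar b eps)].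
Proof.
(* With [b = m + 5], oddness of [b] is evenness of [m]. *)
case: b hodd hb => [|[|[|[|[|m]]]]] //= modd _; rewrite !negbK in modd.
have [eps e0 Heps] := @curve_minimizing R m modd.
have ee : - eps <= eps by lra.
exists eps, eps; rewrite (gamma_curve R modd) (gammabar_curve R modd).
split=> //; split; [apply: horizontal_curve|apply: Heps|apply: horizontal_curve|apply: Heps] => //;
  by rewrite ?expr1n ?sqrrN ?expr1n.
Qed.
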